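(* Let $(X,g)$ be a multi-Eguchi--Hanson or a multi-Taub--NUT space with $k\ge 2$ singular points $p_1,\dots,p_k$ of $\phi$. Let $N$ be a compact $S^1$-invariant minimal surface in $(X,g)$ such that $\gamma:=\pi(N)$ is the straight segment connecting $p_1$ and $p_2$, let $q$ be the midpoint of $\gamma$, and let $2a:=\mathrm{Length}_{\mathbb{R}^3}(\gamma)=|p_1-p_2|$. Suppose that, for some real number $s\ge\max\{\sqrt{(k-2)/2},R_k\}$, one has $|q-p_i|>(s+1)a$ for all $i>2$, where $R_k$ is the largest real root of the polynomial $-4x^3+16x^2+2x+(k-2)$ (the only real root when $k\ge3$). Then $N$ is strongly stable.
   Context: Multi-Eguchi--Hanson and multi-Taub--NUT spaces: let $p_1,\dots,p_k$ be distinct points of $\mathbb{R}^3$, let $m\ge 0$, let $U=\mathbb{R}^3\setminus\{p_1,\dots,p_k\}$, and let $\phi(x)=m+\sum_{i=1}^k \frac{1}{2|x-p_i|}$ on $U$. Let $\pi:X_0\to U$ be the principal $S^1$-bundle (with $S^1=\mathbb{R}/2\pi\mathbb{Z}$) carrying a connection $1$-form $\eta$ (that is, $\eta$ is $S^1$-invariant and $\eta(\xi)=1$, with $\xi$ the infinitesimal generator of the action) such that $d\eta=\pi^*( *_{\mathbb{R}^3}d\phi)$, and put $g=\phi^{-1}\eta^2+\phi\,\pi^*g_{\mathbb{R}^3}$. Adding one point over each $p_i$ yields a smooth complete hyperkähler $4$-manifold $(X,g)$ to which the $S^1$-action extends (fixing the added points), and $\pi$ extends to $\pi:X\to\mathbb{R}^3$.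 It is called a multi-Eguchi--Hanson space if $m=0$ and a multi-Taub--NUT space if $m>0$; the $p_i$ are called the singular points of $\phi$. Minimal means vanishing mean curvature vector. An $S^1$-invariant surface is minimal if and only if its projection to $\mathbb{R}^3$ is a straight segment (or line); so here $N=\pi^{-1}(\gamma)$. Strong stability: for a minimal submanifold $\Sigma$ with second fundamental form $A(X,Y)=(\nabla_XY)^\perp$ and local orthonormal tangent frame $\{e_i\}$, let $\mathcal{R},\mathcal{A}$ be the symmetric operators on the normal bundle with $\langle\mathcal{R}(V),V\rangle=\sum_i\langle R(e_i,V)V,e_i\rangle$ (a sum of sectional curvatures when $|V|=1$) and $\mathcal{A}(V)=\sum_{i,j}\langle A(e_i,e_j),V\rangle A(e_i,e_j)$. $\Sigma$ is strongly stable if $-\mathcal{R}-\mathcal{A}$ is pointwise positive definite on the normal bundle. *)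

(* Defs.v *)
From HB Require Import structures.
From mathcomp Require Import all_boot all_order all_algebra.
From mathcomp Require Import all_classical all_reals all_analysis.

Set Implicit Arguments.
Unset Strict Implicit.
Unset Printing Implicit Defensive.

Import Order.TTheory GRing.Theory Num.Theory.
Import numFieldNormedType.Exports.

Local Open Scope classical_set_scope.
Local Open Scope ring_scope.

(** * Calculus on open subsets of R^n *)

Section Calculus.
Variable R : realType.

Definition dot n (u v : 'rV[R]_n) : R := (u *m v^T) 0 0.

(* The norm `|v| that the library puts on 'rV_n is the sup norm. *)
Definition euclid n (v : 'rV[R]_n) : R := Num.sqrt (dot v v).

(* Indices in 'I_3 are added modulo 3. *)
Definition cross (u v : 'rV[R]_3) : 'rV[R]_3 :=
  \row_(k < 3) (u 0 (k + 1) * v 0 (k + 2) - u 0 (k + 2) * v 0 (k + 1)).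

(* C^r on an open set O.  Directional derivatives at points of O only depend
   on f on a neighbourhood, so the values of f outside O are irrelevant. *)
Fixpoint Cr n (r : nat) (O : set 'rV[R]_n) (f : 'rV[R]_n -> R) : Prop :=
  (forall y, O y -> {for y, continuous f}) /\
  if r is r'.+1 then
    forall i : 'I_n, (forall y, O y -> derivable f y (delta_mx 0 i)) /\
      Cr r' O ('D_(delta_mx 0 i) f)
  else True.

Definition smooth_fun n (O : set 'rV[R]_n) (f : 'rV[R]_n -> R) : Prop :=
  forall r, Cr r O f.

Definition smooth_map n d (O : set 'rV[R]_n) (f : 'rV[R]_n -> 'rV[R]_d) :
    Prop :=
  forall j, smooth_fun O (fun y => f y 0 j).

(* d(alpha)(u, v) for the 1-form sum_i alpha_i dy_i, evaluated on the constant
   (hence commuting) vector fields u and v. *)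
Definition ext_deriv n (alpha : 'rV[R]_n -> 'rV[R]_n) (y u v : 'rV[R]_n) : R :=
  'D_u (fun z => dot (alpha z) v) y - 'D_v (fun z => dot (alpha z) u) y.

(* ( * df)(u, v) = df(u x v), the Hodge star being that of the Euclidean
   oriented R^3. *)
Definition hodge_df (f : 'rV[R]_3 -> R) (x u v : 'rV[R]_3) : R :=
  'D_(cross u v) f x.

(** ** Riemannian geometry of a metric G given by its coefficients *)

Variable n : nat.
Implicit Types (G : 'rV[R]_n -> 'M[R]_n) (y u v w : 'rV[R]_n).

Definition ip (g : 'M[R]_n) u v : R := (u *m g *m v^T) 0 0.

Definition christoffel G y (i j l : 'I_n) : R :=
  2^-1 * \sum_(r < n) invmx (G y) l r *
    ('D_(delta_mx 0 i) (fun z => G z j r) y +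
     'D_(delta_mx 0 j) (fun z => G z i r) y -
     'D_(delta_mx 0 r) (fun z => G z i j) y).

(* Levi-Civita connection: nabla_u Y at y, for a vector field Y *)
Definition cov G u (Y : 'rV[R]_n -> 'rV[R]_n) y : 'rV[R]_n :=
  'D_u Y y +
  \row_(l < n) \sum_(i < n) \sum_(j < n) u 0 i * Y y 0 j * christoffel G y i j l.

(* R(u, v) w = nabla_u nabla_v w - nabla_v nabla_u w - nabla_[u, v] w, for the
   constant vector fields extending u, v, w. *)
Definition curvature G u v w y : 'rV[R]_n :=
  cov G u (cov G v (cst w)) y - cov G v (cov G u (cst w)) y.

(* In this block the submanifold is the slice { y_j = 0 for j >= d }. *)

Definition tangent_slice (d : nat) u : Prop :=
  forall j : 'I_n, (d <= j)%N -> u 0 j = 0.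

Definition tangent_frame d G y (e : 'I_d -> 'rV[R]_n) : Prop :=
  (forall a, tangent_slice d (e a)) /\
  (forall a b, ip (G y) (e a) (e b) = (a == b)%:R).

Definition normal_slice d G y v : Prop :=
  forall u, tangent_slice d u -> ip (G y) v u = 0.

Definition normal_part d G y (e : 'I_d -> 'rV[R]_n) w : 'rV[R]_n :=
  w - \sum_(a < d) ip (G y) w (e a) *: e a.

(* A(u, v) = (nabla_u v)^perp.  For v tangent to the slice, the constant vector
   field v is tangent to the slice along it. *)
Definition second_ff d G y (e : 'I_d -> 'rV[R]_n) u v : 'rV[R]_n :=
  normal_part G y e (cov G u (cst v) y).

Definition mean_curvature d G y (e : 'I_d -> 'rV[R]_n) : 'rV[R]_n :=
  \sum_(a < d) second_ff G y e (e a) (e a).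

Definition calR_form d G y (e : 'I_d -> 'rV[R]_n) v : R :=
  \sum_(a < d) ip (G y) (curvature G (e a) v v y) (e a).

Definition calA d G y (e : 'I_d -> 'rV[R]_n) v : 'rV[R]_n :=
  \sum_(a < d) \sum_(b < d)
    ip (G y) (second_ff G y e (e a) (e b)) v *: second_ff G y e (e a) (e b).

End Calculus.

(** * Smooth manifolds *)

(* Only the values of chart_map on chart_dom, and those of chart_inv on the
   image of chart_dom, are meaningful. *)
Record chart (R : realType) (T : topologicalType) (n : nat) := Chart {
  chart_dom : set T;
  chart_map : T -> 'rV[R]_n;
  chart_inv : 'rV[R]_n -> T;
  chart_dom_open : open chart_dom;
  chart_img_open : open (chart_map @` chart_dom);
  chart_mapK : forall x, chart_dom x -> chart_inv (chart_map x) = x;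
  chart_map_cont : forall x, chart_dom x -> {for x, continuous chart_map};
  chart_inv_cont : forall y, (chart_map @` chart_dom) y ->
    {for y, continuous chart_inv}
}.

Section Charts.
Variables (R : realType) (T : topologicalType) (n : nat).
Implicit Types c : chart R T n.

Definition chart_img c (W : set T) : set 'rV[R]_n :=
  chart_map c @` (W `&` chart_dom c).

Definition transition c c' : 'rV[R]_n -> 'rV[R]_n :=
  chart_map c' \o chart_inv c.

Definition compatible c c' : Prop :=
  smooth_map (chart_img c (chart_dom c')) (transition c c') /\
  smooth_map (chart_img c' (chart_dom c)) (transition c' c).

End Charts.

Record manifold (R : realType) (n : nat) := Manifold {
  carrier :> topologicalType;
  atlas : set (chart R carrier n);
  manifold_hausdorff : hausdorff_space carrier;
  manifold_second_countable : @second_countable carrier;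
  atlas_cover : forall x, exists2 c, atlas c & chart_dom c x;
  atlas_compatible : forall c c', atlas c -> atlas c' -> compatible c c';
  atlas_maximal : forall c, (forall c', atlas c' -> compatible c c') -> atlas c
}.

Section Manifolds.
Variables (R : realType) (n : nat) (M : manifold R n).
Implicit Types (c : chart R M n) (W : set M) (x : M).

(* smooth map from the open subset W of M to R^d *)
Definition smooth_from d W (f : M -> 'rV[R]_d) : Prop :=
  forall c, atlas c -> smooth_map (chart_img c W) (f \o chart_inv c).

(* smooth map from the open subset O of R^d to M *)
Definition smooth_to d (O : set 'rV[R]_d) (F : 'rV[R]_d -> M) : Prop :=
  (forall z, O z -> {for z, continuous F}) /\
  (forall c, atlas c ->
    smooth_map (O `&` F @^-1` chart_dom c) (chart_map c \o F)).

(* A 1-form is given by its row of coefficients in each chart. *)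
Definition one_form W (alpha : chart R M n -> 'rV[R]_n -> 'rV[R]_n) : Prop :=
  (forall c, atlas c -> smooth_map (chart_img c W) (alpha c)) /\
  (forall c c' y, atlas c -> atlas c' -> chart_img c (W `&` chart_dom c') y ->
    alpha c y =
      alpha c' (transition c c' y) *m ('J (transition c c') y)^T).

(* A Riemannian metric is given by its matrix of coefficients in each chart. *)
Record riemannian := Riemannian {
  metric :> chart R M n -> 'rV[R]_n -> 'M[R]_n;
  metric_smooth : forall c i j, atlas c ->
    smooth_fun (chart_img c setT) (fun y => metric c y i j);
  metric_sym : forall c y, atlas c -> chart_img c setT y ->
    (metric c y)^T = metric c y;
  metric_pos : forall c y u, atlas c -> chart_img c setT y -> u != 0 ->
    0 < ip (metric c y) u u;
  metric_transition : forall c c' y, atlas c -> atlas c' ->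
    chart_img c (chart_dom c') y ->
    metric c y = 'J (transition c c') y *m
      metric c' (transition c c' y) *m ('J (transition c c') y)^T
}.

(** ** Embedded submanifolds *)

Definition slice_chart d (N : set M) c : Prop :=
  atlas c /\
  (forall x, chart_dom c x -> (N x <-> tangent_slice d (chart_map c x))).

Definition submanifold d (N : set M) : Prop :=
  forall x, N x -> exists2 c, slice_chart d N c & chart_dom c x.

Definition minimal (g : riemannian) d (N : set M) : Prop :=
  forall c x (e : 'I_d -> 'rV[R]_n), slice_chart d N c -> chart_dom c x ->
    N x -> tangent_frame (g c) (chart_map c x) e ->
    mean_curvature (g c) (chart_map c x) e = 0.

Definition strongly_stable (g : riemannian) d (N : set M) : Prop :=
  forall c x (e : 'I_d -> 'rV[R]_n) v, slice_chart d N c -> chart_dom c x ->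
    N x -> let y := chart_map c x in
    tangent_frame (g c) y e -> normal_slice d (g c) y v -> v != 0 ->
    0 < - calR_form (g c) y e v - ip (g c y) (calA (g c) y e v) v.

(** ** Circle actions, with S^1 = R / 2 pi Z *)

Definition circle_action (act : R -> M -> M) : Prop :=
  [/\ forall x, act 0 x = x,
      forall s t x, act (s + t) x = act s (act t x),
      forall x, act (2 * pi) x = x &
      forall c, atlas c ->
        smooth_to [set z : 'rV[R]_(n + 1) | chart_img c setT (lsubmx z)]
          (fun z => act (rsubmx z 0 0) (chart_inv c (lsubmx z)))].

(* infinitesimal generator, in the chart c at the point of coordinates y *)
Definition generator (act : R -> M -> M) c (y : 'rV[R]_n) : 'rV[R]_n :=
  derive1 (fun t : R => chart_map c (act t (chart_inv c y))) 0.

Definition unit_circle (t : R) : 'rV[R]_2 :=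
  \row_(j < 2) (if j == 0 then cos t else sin t).

(* Psi, which is 2 pi-periodic in its second argument, induces an equivariant
   diffeomorphism W x S^1 -> proj^-1(W) over W, with inverse (proj, tau), where
   S^1 is embedded in R^2 by unit_circle. *)
Definition local_trivialization d (act : R -> M -> M) (proj : M -> 'rV[R]_d)
    (W : set 'rV[R]_d) (Psi : 'rV[R]_d -> R -> M) (tau : M -> 'rV[R]_2) :
    Prop :=
  [/\ smooth_to [set z : 'rV[R]_(d + 1) | W (lsubmx z)]
        (fun z => Psi (lsubmx z) (rsubmx z 0 0)),
      smooth_from (proj @^-1` W) tau,
      forall w t, W w -> proj (Psi w t) = w /\ tau (Psi w t) = unit_circle t,
      forall w s t, W w -> Psi w (s + t) = act s (Psi w t) &
      forall x, W (proj x) -> exists t, Psi (proj x) t = x].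

Definition principal_circle_bundle d (act : R -> M -> M)
    (proj : M -> 'rV[R]_d) (U : set 'rV[R]_d) : Prop :=
  (forall t x, U (proj x) -> proj (act t x) = proj x) /\
  (forall w, U w -> exists (W : set 'rV[R]_d) Psi tau,
    [/\ open W, W w, W `<=` U & local_trivialization act proj W Psi tau]).

Definition connection_form (act : R -> M -> M) W
    (eta : chart R M n -> 'rV[R]_n -> 'rV[R]_n) : Prop :=
  [/\ one_form W eta,
      forall c c' t y, atlas c -> atlas c' -> chart_img c W y ->
        chart_dom c' (act t (chart_inv c y)) ->
        let F := chart_map c' \o act t \o chart_inv c in
        eta c y = eta c' (F y) *m ('J F y)^T &
      forall c y, atlas c -> chart_img c W y ->
        dot (eta c y) (generator act c y) = 1].

End Manifolds.

(** * Multi-Eguchi--Hanson and multi-Taub--NUT spaces *)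

Section GibbonsHawking.
Variables (R : realType) (k : nat) (p : 'I_k -> 'rV[R]_3) (m : R).

Definition gh_base : set 'rV[R]_3 := ~` range p.

Definition gh_potential (x : 'rV[R]_3) : R :=
  m + \sum_(i < k) (2 * euclid (x - p i))^-1.

(* The requirement that gh_manifold and gh_metric be smooth, also at the point
   over each p i, makes this the smooth extension of the bundle over gh_base;
   completeness is then automatic. *)
Record gibbons_hawking := GibbonsHawking {
  gh_manifold :> manifold R 4;
  gh_metric : riemannian gh_manifold;
  gh_act : R -> gh_manifold -> gh_manifold;
  gh_proj : gh_manifold -> 'rV[R]_3;
  gh_conn : chart R gh_manifold 4 -> 'rV[R]_4 -> 'rV[R]_4;
  gh_circle_action : circle_action gh_act;
  gh_proj_smooth : smooth_from setT gh_proj;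
  gh_bundle : principal_circle_bundle gh_act gh_proj gh_base;
  gh_connection : connection_form gh_act (gh_proj @^-1` gh_base) gh_conn;
  (* d eta = proj^* ( * d phi) *)
  gh_monopole : forall c y u v, atlas c ->
    chart_img c (gh_proj @^-1` gh_base) y ->
    let f := gh_proj \o chart_inv c in
    ext_deriv (gh_conn c) y u v =
      hodge_df gh_potential (f y) (u *m 'J f y) (v *m 'J f y);
  (* g = phi^-1 eta^2 + phi proj^* g_{R^3} *)
  gh_metricE : forall c y u v, atlas c ->
    chart_img c (gh_proj @^-1` gh_base) y ->
    let f := gh_proj \o chart_inv c in
    ip (gh_metric c y) u v =
      (gh_potential (f y))^-1 * dot (gh_conn c y) u * dot (gh_conn c y) v +
      gh_potential (f y) * dot (u *m 'J f y) (v *m 'J f y);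
  gh_singular_fiber : forall i, exists! x, gh_proj x = p i;
  gh_singular_fixed : forall i t x, gh_proj x = p i -> gh_act t x = x
}.

End GibbonsHawking.

Definition multi_Eguchi_Hanson (R : realType) k (p : 'I_k -> 'rV[R]_3) (m : R)
  (X : gibbons_hawking p m) : Prop := m = 0.

Definition multi_Taub_NUT (R : realType) k (p : 'I_k -> 'rV[R]_3) (m : R)
  (X : gibbons_hawking p m) : Prop := 0 < m.

Definition circle_invariant (R : realType) k (p : 'I_k -> 'rV[R]_3) (m : R)
  (X : gibbons_hawking p m) (N : set X) : Prop :=
  forall t x, N x -> N (gh_act t x).

Definition straight_segment (R : realType) n (u v : 'rV[R]_n) :
    set 'rV[R]_n :=
  [set (1 - t) *: u + t *: v | t in `[0, 1]].

Definition threshold_poly (R : realType) (k : nat) : {poly R} :=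
  (-4) *: 'X^3 + 16 *: 'X^2 + 2 *: 'X + (k%:R - 2)%:P.

Definition largest_root (R : realType) (P : {poly R}) (r : R) : Prop :=
  root P r /\ forall x, root P x -> x <= r.

(* Main.v *)
(** Over the complement of the points [p i] use the coframe [eta, df_1, df_2,
    df_3], where [f] is the projection in an oriented orthonormal basis of [R^3]
    whose first vector is the direction of the segment.  Its structure equations
    are [d(eta) = *d(phi)] and [d(df_i) = 0], so the Koszul formula gives the
    Levi-Civita connection and the curvature in terms of [phi], its gradient and
    its Hessian.  Along a surface over a line in the first direction, using that
    [phi] is harmonic, [-calR - calA] is the multiple
      [(phi phi_11 - 2 phi_1^2) / (2 phi^3) = - (1 / phi)'' / 2]
    of the metric on the normal bundle, that is, the Gauss curvature of the
    surface.  With [x] the signed distance to the midpoint of the segment,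
    [phi = a / (a^2 - x^2) + P], where [P] collects [m] and the far points;
    the Cauchy-Schwarz inequality [P'^2 <= P Q], where [P'' = 3 Q - T], bounds
    this curvature below by
      [(2 a - u^2 T) / (2 (a + u P)^2)] with [u = a^2 - x^2],
    and [T] is small because the other points are far away.  This bound is
    uniform on the open segment, hence by continuity of the curvature it also
    holds at the two fixed points over its ends. *)

From HB Require Import structures.
Require Import Defs.
From mathcomp Require Import all_boot all_order all_algebra.
From mathcomp Require Import all_classical all_reals all_analysis.
From mathcomp Require Import ring lra.
Set Implicit Arguments.
Unset Strict Implicit.
Unset Printing Implicit Defensive.
Import Order.TTheory GRing.Theory Num.Theory.
Import numFieldNormedType.Exports.
Local Open Scope classical_set_scope.
Local Open Scope ring_scope.

(** * Differentiability and smooth functions *)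

(** The stability form is defined through constant coordinate fields, while the geometry is simple
    only in the coframe. A constant field is therefore followed through its non-constant components
    [hat]: in the curvature their second derivatives cancel by Schwarz's theorem, and their first
    derivatives enter only through the structure equations. What remains is algebra in [phi], its
    gradient and its Hessian. Smoothness being given by iterated axis derivatives, linearity in the
    direction and Schwarz's theorem have to be derived from it.

    The coframe is left orthogonal, not orthonormal, so that no root of [phi] occurs. The far points
    need not lie on the line of the segment, so [N] is in general not totally geodesic; the normal
    part of the gradient contributes to [calR] and to [calA], and the two contributions cancel.

    The condition on [Rk] acts through [k - 2 < 4 s^3], which is the positivity of the bound once
    every far distance is replaced by [s a]. Positivity on the open segment alone would yield a weak
    inequality at its ends, where the coframe breaks down; hence the explicit constant. *)

Section FiniteSums.
Context {R : realType} {T I : Type} {F : set_system T} {FF : Filter F}.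

Lemma cvg_sumr (r : seq I) (P : pred I) (f : I -> T -> R) (l : I -> R) :
  (forall i, P i -> f i x @[x --> F] --> l i) ->
  (\sum_(i <- r | P i) f i x) @[x --> F] --> \sum_(i <- r | P i) l i.
Proof. exact: (cvg_big (@add_continuous R) FF). Qed.

End FiniteSums.

Section Differentiability.
Context {R : realType}.

Lemma is_derive_line (V : normedModType R) (f : V -> R) (y u : V) (s : R) :
  derivable f (y + s *: u) u ->
  is_derive s 1 (fun t : R => f (y + t *: u)) ('D_u f (y + s *: u)).
Proof.
have E : (fun h : R => h^-1 *: (((fun t : R => f (y + t *: u)) \o shift s)
      (h *: 1) - f (y + s *: u))) =
    (fun h : R => h^-1 *: ((f \o shift (y + s *: u)) (h *: u) -
      f (y + s *: u))).
  apply/funext => h /=; congr (_ *: (f _ - _)).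
  by rewrite [h *: 1]mulr1 scalerDl addrCA.
by move=> df; split; rewrite /derivable /derive E.
Qed.

(** Bounding [s] by the absolute value of [t] lets one statement serve both signs of [t]. *)
Lemma MVT_line (V : normedModType R) (f : V -> R) (y u : V) (t : R) :
  (forall s : R, `|s| <= `|t| -> derivable f (y + s *: u) u) ->
  exists2 s, `|s| <= `|t| & f (y + t *: u) - f y = t * 'D_u f (y + s *: u).
Proof.
move=> df; pose g s := f (y + s *: u).
have dg (s : R) : `|s| <= `|t| -> is_derive s 1 g ('D_u f (y + s *: u)).
  by move=> /df/is_derive_line.
have cg a b : (forall s, s \in `[a, b]%R -> `|s| <= `|t|) ->
    {within `[a, b], continuous g}.
  move=> H; apply: continuous_in_subspaceT => x; rewrite inE /= => xab.
  apply: differentiable_continuous; apply/derivable1_diffP.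
  by have [] := dg x (H _ xab).
have g0 : g 0 = f y by rewrite /g scale0r addr0.
have [t0|t0] := leP 0 t.
  have H s : s \in `[0, t]%R -> `|s| <= `|t|.
    by rewrite in_itv /= => /andP[s0 st]; rewrite !ger0_norm.
  have D x : x \in `]0, t[%R -> is_derive x 1 g ('D_u f (y + x *: u)).
    by move=> xt; apply: dg; apply: H; exact: subset_itv_oo_cc.
  have [s /H st E] := MVT_segment t0 D (cg _ _ H).
  by exists s => //; rewrite -/(g t) -g0 E subr0 mulrC.
have H s : s \in `[t, 0]%R -> `|s| <= `|t|.
  rewrite in_itv /= => /andP[s0 st].
  by rewrite !ler0_norm// ?lerN2// ltW.
have D x : x \in `]t, 0[%R -> is_derive x 1 g ('D_u f (y + x *: u)).
  by move=> xt; apply: dg; apply: H; exact: subset_itv_oo_cc.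
have [s /H st E] := MVT_segment (ltW t0) D (cg _ _ H).
exists s => //; rewrite -/(g t) -g0; apply: oppr_inj.
by rewrite opprB E sub0r mulrN mulrC.
Qed.

Lemma differentiable_of_linear (V W : normedModType R) (f : V -> W)
    (df : {linear V -> W}) (y : V) : continuous df ->
  (forall e : R, 0 < e -> \forall h \near (0 : V),
    `|f (h + y) - (f y + df h)| <= e * `|h|) ->
  differentiable f y /\ 'd f y = df :> (V -> W).
Proof.
move=> dfc H.
have E : f \o shift y = cst (f y) + df +o_ 0 id by apply/eqaddoP.
have dE : 'd f y = df :> (V -> W) by exact: diff_unique.
by split=> //; apply/diff_locallyP; rewrite dE.
Qed.

Section C1.
Variable n : nat.
Implicit Types (O : set 'rV[R]_n) (f : 'rV[R]_n -> R) (y u : 'rV[R]_n).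

(** The candidate for the differential, given the bundled linear structure that
    [differentiable_of_linear] demands. *)
Definition row_form (c : 'I_n -> R) (u : 'rV[R]_n) : R :=
  \sum_(i < n) u 0 i * c i.

Lemma row_form_is_linear c : linear (row_form c).
Proof.
move=> k u v; rewrite /row_form scaler_sumr -big_split /=.
by apply: eq_bigr => i _; rewrite !mxE mulrDl -scalerAl.
Qed.
HB.instance Definition _ c :=
  GRing.isLinear.Build R 'rV[R]_n R _ (row_form c) (row_form_is_linear c).

Lemma row_form_continuous c : continuous (row_form c).
Proof.
move=> u; apply: (@cvg_sumr _ _ _ (nbhs u)) => i _.
by apply: cvgMr_tmp; exact: coord_continuous.
Qed.

(** Go from [y] to [y + h] one coordinate at a time. The mean value theorem turns each increment
    into a partial derivative at a nearby point, and continuity at [y] replaces it by its value at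
    [y]. *)
Lemma C1_differentiable O f y : open O -> O y ->
  (forall i z, O z -> derivable f z (delta_mx 0 i)) ->
  (forall i, {for y, continuous ('D_(delta_mx 0 i) f)}) ->
  differentiable f y /\
  forall u, 'd f y u = \sum_(i < n) u 0 i * 'D_(delta_mx 0 i) f y.
Proof.
move=> oO Oy df cf.
pose c i := 'D_(delta_mx 0 i) f y.
have E e : 0 < e -> \forall h \near (0 : 'rV[R]_n),
    `|f (h + y) - (f y + row_form c h)| <= e * `|h|.
  (* [n.+1] is nonzero even for [n = 0], and still bounds the number of increments. *)
  move=> e0; have e'0 : 0 < e / n.+1%:R by rewrite divr_gt0.
  have /nbhs_ballP[d /= d0 dP] : \forall z \near y,
      O z /\ forall i, `|'D_(delta_mx 0 i) f z - c i| < e / n.+1%:R.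
    near=> z; split; first by near: z; exact: open_nbhs_nbhs.
    near: z; apply: filter_forall => i; move/cvgrPdist_lt : (cf i).
    by move=> /(_ _ e'0); apply: filterS => z; rewrite distrC.
  near=> h.
  have hd : `|h| < d by near: h; apply: (@nbhs0_lt R 'rV[R]_n).
  pose H j : 'rV[R]_n := \row_i (if (i < j)%N then h 0 i else 0).
  have H0 : H 0%N = 0 by apply/rowP => i; rewrite !mxE.
  have Hn : H n = h by apply/rowP => i; rewrite !mxE ltn_ord.
  have HS (j : 'I_n) : H j.+1 = H j + h 0 j *: delta_mx 0 j.
    apply/rowP => i; rewrite !mxE eqxx /= -val_eqE/= ltnS leq_eqVlt eq_sym.
    case: eqVneq => [/val_inj ->|_] /=; first by rewrite ltnn add0r mulr1.
    by rewrite mulr0 addr0.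
  have coord i : `|h 0 i| <= `|h|.
    rewrite [leRHS]/Num.Def.normr/= mx_normrE.
    exact: (le_bigmax _ (fun k => `|h k.1 k.2|) (0, i)).
  (* For the sup norm the whole polygonal path stays within the norm of [h] of [y]. *)
  have small (j : 'I_n) s : `|s| <= `|h 0 j| ->
      ball y d (y + H j + s *: delta_mx 0 j).
    move=> sj; rewrite -ball_normE /= opprD addrA opprD addrA subrr sub0r -opprD.
    rewrite normrN; apply: le_lt_trans hd.
    rewrite [leLHS]/Num.Def.normr/= mx_normrE.
    apply: bigmax_le => // -[i0 i] _ /=; rewrite !mxE ord1 eqxx /=.
    case: eqVneq => [->|_]; first by rewrite ltnn add0r mulr1 (le_trans sj).
    by rewrite mulr0 addr0; case: ifP => _; rewrite ?normr0.
  have step (j : 'I_n) : exists2 z, ball y d z &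
      f (y + H j.+1) - f (y + H j) = h 0 j * 'D_(delta_mx 0 j) f z.
    have [|s sj Es] := @MVT_line _ f (y + H j) (delta_mx 0 j) (h 0 j).
      by move=> s sj; apply: df; have [] := dP _ (small _ _ sj).
    by exists (y + H j + s *: delta_mx 0 j); [exact: small|rewrite HS addrA].
  have -> : f (h + y) - (f y + row_form c h) =
      \sum_(j < n) (f (y + H j.+1) - f (y + H j) - h 0 j * c j).
    rewrite sumrB -(big_mkord xpredT (fun j => f (y + H j.+1) - f (y + H j))).
    rewrite telescope_sumr// H0 Hn addr0 /row_form.
    by rewrite opprD addrA [h + y]addrC.
  apply: (le_trans (ler_norm_sum _ _ _)).
  apply: (@le_trans _ _ (\sum_(j < n) (e / n.+1%:R * `|h|))).
    apply: ler_sum => j _; have [z /dP[_ /(_ j) zc] ->] := step j.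
    by rewrite -mulrBr normrM mulrC ler_pM// ltW.
  rewrite sumr_const card_ord -[leLHS]mulr_natl mulrA ler_wpM2r//=.
  by rewrite mulrCA ler_piMr ?ltW// ltr_pdivrMr// mul1r ltr_nat.
have [fy dE] := @differentiable_of_linear _ _ _ _ _ (@row_form_continuous c) E.
by split => // u; rewrite dE.
Unshelve. all: by end_near. Qed.

End C1.
End Differentiability.

Section Smoothness.
Context {R : realType} {n : nat}.
Implicit Types (O : set 'rV[R]_n) (f g : 'rV[R]_n -> R) (y u v : 'rV[R]_n).

Lemma open_near_eq O (T : Type) (f g : 'rV[R]_n -> T) y : open O -> O y ->
  (forall z, O z -> f z = g z) -> \forall z \near y, f z = g z.
Proof.
by move=> oO Oy fg; near=> z; apply: fg; near: z; exact: open_nbhs_nbhs.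
Unshelve. all: by end_near. Qed.

Lemma continuous_ext O f g y : open O -> O y ->
  (forall z, O z -> f z = g z) -> {for y, continuous f} ->
  {for y, continuous g}.
Proof.
move=> oO Oy fg cf; rewrite /prop_for /continuous_at -(fg _ Oy).
apply: cvg_trans cf; apply: (@near_eq_cvg _ _ (nbhs y) _ f g).
exact: (open_near_eq oO Oy).
Qed.

(** The rules for derivatives of sums, products and inverses are available only on [O], so the
    closure properties below rest on equality on [O]. *)
Lemma Cr_ext r O f g : open O -> (forall y, O y -> f y = g y) ->
  Cr r O f -> Cr r O g.
Proof.
move=> oO; elim: r f g => [|r IH] f g fg /= [cf df]; split.
- by move=> y Oy; apply: (continuous_ext oO Oy fg); exact: cf.
- by [].
- by move=> y Oy; apply: (continuous_ext oO Oy fg); exact: cf.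
move=> i; have [dfi Cfi] := df i; split.
  by move=> y Oy; apply: near_eq_derivable (dfi _ Oy); exact: open_near_eq Oy fg.
apply: IH Cfi => y Oy; apply: near_eq_derive; exact: open_near_eq Oy fg.
Qed.

Lemma Cr_continuous r O f y : Cr r O f -> O y -> {for y, continuous f}.
Proof. by case: r => [|r] [cf _] /cf. Qed.

Lemma Cr_derivable r O f y i : Cr r.+1 O f -> O y ->
  derivable f y (delta_mx 0 i).
Proof. by move=> [_ df] /(df i).1. Qed.

Lemma CrW r O f : Cr r.+1 O f -> Cr r O f.
Proof.
elim: r f => [|r IH] f [cf df]; split=> // i.
by have [dfi Cfi] := df i; split => //; exact: IH.
Qed.

Lemma Cr_subset r O O' f : O' `<=` O -> Cr r O f -> Cr r O' f.
Proof.
move=> OO'; elim: r f => [|r IH] f [cf df]; split=> //.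
- by move=> y /OO'/cf.
- by move=> y /OO'/cf.
move=> i; have [dfi Cfi] := df i; split; last exact: IH.
by move=> y /OO'/dfi.
Qed.

Lemma Cr_cst r O (a : R) : Cr r O (cst a).
Proof.
elim: r a => [|r IH] a; split=> //.
- by move=> y _; exact: cst_continuous.
- by move=> y _; exact: cst_continuous.
move=> i; split; first by move=> y _; exact: derivable_cst.
rewrite (_ : 'D_(delta_mx 0 i) (cst a) = cst 0) //.
by apply/funext => y; rewrite derive_cst.
Qed.

Lemma CrD r O f g : open O -> Cr r O f -> Cr r O g -> Cr r O (f \+ g).
Proof.
move=> oO; elim: r f g => [|r IH] f g Cf Cg; split=> //.
- move=> y Oy; apply: continuousD; [exact: Cr_continuous Cf _|].
  exact: Cr_continuous Cg _.
- move=> y Oy; apply: continuousD; [exact: Cr_continuous Cf _|].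
  exact: Cr_continuous Cg _.
move=> i; split.
  by move=> y Oy; apply: derivableD; [exact: Cr_derivable Cf _|exact: Cr_derivable Cg _].
apply: Cr_ext (IH _ _ (Cf.2 i).2 (Cg.2 i).2) => // y Oy.
by rewrite deriveD//; [exact: Cr_derivable Cf _|exact: Cr_derivable Cg _].
Qed.

Lemma CrM r O f g : open O -> Cr r O f -> Cr r O g -> Cr r O (f \* g).
Proof.
move=> oO; elim: r f g => [|r IH] f g Cf Cg; split=> //.
- move=> y Oy; apply: continuousM; [exact: Cr_continuous Cf _|].
  exact: Cr_continuous Cg _.
- move=> y Oy; apply: continuousM; [exact: Cr_continuous Cf _|].
  exact: Cr_continuous Cg _.
move=> i; split.
  by move=> y Oy; apply: derivableM; [exact: Cr_derivable Cf _|exact: Cr_derivable Cg _].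
apply: Cr_ext (CrD oO (IH _ _ (CrW Cf) (Cg.2 i).2)
  (IH _ _ (CrW Cg) (Cf.2 i).2)) => // y Oy.
by rewrite deriveM//; [exact: Cr_derivable Cf _|exact: Cr_derivable Cg _].
Qed.

Lemma CrV r O f : open O -> (forall y, O y -> f y != 0) -> Cr r O f ->
  Cr r O (fun y => (f y)^-1).
Proof.
move=> oO f0; elim: r f f0 => [|r IH] f f0 Cf; split=> //.
- by move=> y Oy; apply: continuousV; [exact: f0|exact: Cr_continuous Cf _].
- by move=> y Oy; apply: continuousV; [exact: f0|exact: Cr_continuous Cf _].
move=> i; split.
  by move=> y Oy; apply: derivableV; [exact: f0|exact: Cr_derivable Cf _].
have CV := IH _ f0 (CrW Cf).
apply: Cr_ext (CrM oO (Cr_cst r O (-1)) (CrM oO (CrM oO CV CV) (Cf.2 i).2)) => //.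
move=> y Oy /=; rewrite deriveV ?f0//; last exact: Cr_derivable Cf _.
by rewrite /GRing.scale/= mulN1r -invfM -expr2 mulNr.
Qed.

Lemma smooth_ext O f g : open O -> (forall y, O y -> f y = g y) ->
  smooth_fun O f -> smooth_fun O g.
Proof. by move=> oO fg sf r; apply: Cr_ext fg _ => //; exact: sf. Qed.

Lemma smooth_subset O O' f : O' `<=` O -> smooth_fun O f -> smooth_fun O' f.
Proof. by move=> OO' sf r; apply: Cr_subset OO' _; exact: sf. Qed.

Lemma smooth_cst O (a : R) : smooth_fun O (cst a).
Proof. by move=> r; exact: Cr_cst. Qed.

Lemma smoothD O f g : open O -> smooth_fun O f -> smooth_fun O g ->
  smooth_fun O (fun y => f y + g y).
Proof. by move=> oO sf sg r; exact: CrD. Qed.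

Lemma smoothM O f g : open O -> smooth_fun O f -> smooth_fun O g ->
  smooth_fun O (fun y => f y * g y).
Proof. by move=> oO sf sg r; exact: CrM. Qed.

Lemma smoothZ O (a : R) f : open O -> smooth_fun O f ->
  smooth_fun O (fun y => a * f y).
Proof. by move=> oO; apply: smoothM => //; exact: smooth_cst. Qed.

Lemma smoothB O f g : open O -> smooth_fun O f -> smooth_fun O g ->
  smooth_fun O (fun y => f y - g y).
Proof.
move=> oO sf sg; apply: smooth_ext (smoothD oO sf (smoothZ (-1) oO sg)) => //.
by move=> y _; rewrite mulN1r.
Qed.

Lemma smoothV O f : open O -> (forall y, O y -> f y != 0) ->
  smooth_fun O f -> smooth_fun O (fun y => (f y)^-1).
Proof. by move=> oO f0 sf r; exact: CrV. Qed.

Lemma smooth_sum O (I : Type) (s : seq I) (P : pred I) (F : I -> 'rV[R]_n -> R) :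
  open O -> (forall i, P i -> smooth_fun O (F i)) ->
  smooth_fun O (fun y => \sum_(i <- s | P i) F i y).
Proof.
move=> oO sF; elim: s => [|i s IH].
  by apply: smooth_ext (smooth_cst O 0) => // y _; rewrite big_nil.
have [Pi|nPi] := boolP (P i).
  apply: smooth_ext (smoothD oO (sF i Pi) IH) => // y _.
  by rewrite big_cons Pi.
by apply: smooth_ext IH => // y _; rewrite big_cons (negbTE nPi).
Qed.

Lemma smooth_prod O (I : Type) (s : seq I) (P : pred I) (F : I -> 'rV[R]_n -> R) :
  open O -> (forall i, P i -> smooth_fun O (F i)) ->
  smooth_fun O (fun y => \prod_(i <- s | P i) F i y).
Proof.
move=> oO sF; elim: s => [|i s IH].
  by apply: smooth_ext (smooth_cst O 1) => // y _; rewrite big_nil.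
have [Pi|nPi] := boolP (P i).
  apply: smooth_ext (smoothM oO (sF i Pi) IH) => // y _.
  by rewrite big_cons Pi.
by apply: smooth_ext IH => // y _; rewrite big_cons (negbTE nPi).
Qed.

Lemma smooth_continuous O f y : smooth_fun O f -> O y -> {for y, continuous f}.
Proof. by move=> sf; apply: Cr_continuous (sf 0%N). Qed.

Lemma smooth_partial O f i : smooth_fun O f ->
  smooth_fun O ('D_(delta_mx 0 i) f).
Proof. by move=> sf r; have [_ /(_ i)[]] := sf r.+1. Qed.

Section Derivatives.
Variables (O : set 'rV[R]_n) (f : 'rV[R]_n -> R).
Hypotheses (oO : open O) (sf : smooth_fun O f).

Lemma smooth_diff y : O y -> differentiable f y /\
  forall u, 'd f y u = \sum_(i < n) u 0 i * 'D_(delta_mx 0 i) f y.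
Proof.
move=> Oy; apply: (C1_differentiable oO Oy).
  by move=> i z Oz; exact: Cr_derivable (sf 1) Oz.
by move=> i; exact: smooth_continuous (smooth_partial i sf) Oy.
Qed.

Lemma smooth_derivable y u : O y -> derivable f y u.
Proof. by move=> /smooth_diff[df _]; exact: diff_derivable. Qed.

Lemma smooth_is_derive y u : O y -> is_derive y u f ('D_u f y).
Proof. by move=> Oy; apply: derivableP; exact: smooth_derivable. Qed.

Lemma smooth_deriveE y u : O y ->
  'D_u f y = \sum_(i < n) u 0 i * 'D_(delta_mx 0 i) f y.
Proof. by move=> /smooth_diff[df <-]; rewrite deriveE. Qed.

Lemma smooth_derive u : smooth_fun O ('D_u f).
Proof.
have S := @smooth_sum O 'I_n (index_enum 'I_n) xpredT
  (fun i y => u 0 i * 'D_(delta_mx 0 i) f y) oO.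
apply: (smooth_ext oO _ (S _)).
  by move=> y /smooth_deriveE.
by move=> i _; apply: smoothZ => //; exact: smooth_partial.
Qed.

End Derivatives.

Lemma is_derive_translate (f : 'rV[R]_n -> R) c y u :
  derivable f (y + c) u ->
  is_derive y u (fun z => f (z + c)) ('D_u f (y + c)).
Proof.
have E : (fun h : R => h^-1 *: (((fun z => f (z + c)) \o shift y)
      (h *: u) - f (y + c))) =
    (fun h : R => h^-1 *: ((f \o shift (y + c)) (h *: u) - f (y + c))).
  by apply/funext => h /=; rewrite addrA.
by move=> df; split; rewrite /derivable /derive E.
Qed.

(** Symmetric in [u] and [v]: divided by [t ^+ 2] it tends to one mixed derivative, and with the
    roles exchanged to the other. *)
Definition second_difference f y u v : R :=
  f (y + u + v) - f (y + u) - f (y + v) + f y.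

Lemma second_difference_near O f y u v (e : R) : open O -> smooth_fun O f ->
  O y -> 0 < e -> exists2 d : R, 0 < d & forall t : R, `|t| < d -> t != 0 ->
    `|second_difference f y (t *: u) (t *: v) / t ^+ 2 - 'D_u ('D_v f) y| < e.
Proof.
move=> oO sf Oy e0.
have sDf := smooth_derive oO sf v.
have sDDf := smooth_derive oO sDf u.
pose D := 'D_u ('D_v f).
have cD : D z @[z --> y] --> D y by exact: (smooth_continuous sDDf Oy).
have DP : \forall z \near y, `|D y - D z| < e.
  by move/cvgrPdist_lt : cD => /(_ _ e0).
have /nbhs_ballP[r /= r0 rP] : \forall z \near y, O z /\ `|D z - D y| < e.
  near=> z; split; first by near: z; exact: open_nbhs_nbhs.
  by rewrite distrC; near: z.
(* The summand [1] keeps the divisor below positive when [u] and [v] vanish. *)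
have K0 : 0 < `|u| + `|v| + 1.
  by apply: ltr_wpDl => //; rewrite addr_ge0.
exists (r / (`|u| + `|v| + 1)); first by rewrite divr_gt0.
move=> t; rewrite ltr_pdivlMr// => tr t0.
have small (a b : R) : `|a| <= `|t| -> `|b| <= `|t| ->
    ball y r (y + a *: v + b *: u).
  move=> at_ bt; rewrite -ball_normE /= opprD addrA opprD addrA subrr sub0r -opprD.
  rewrite normrN; apply: le_lt_trans tr.
  apply: (le_trans (ler_normD _ _)); rewrite !normrZ mulrDr mulrDr mulr1.
  rewrite -[leLHS]addr0 lerD// addrC lerD// ler_wpM2r//.
(* The second difference is the increment of [F] along [v]; the mean value theorem is applied along
   [v] and then along [u]. *)
pose F z := f (z + t *: u) - f z.
have dF s : `|s| <= `|t| -> is_derive (y + s *: v) v F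
    ('D_v f (y + s *: v + t *: u) - 'D_v f (y + s *: v)).
  move=> st; apply: is_deriveB.
    apply: is_derive_translate; apply: (smooth_derivable oO sf).
    by have [] := rP _ (small _ _ st (lexx _)).
  apply: (smooth_is_derive oO sf).
  have := small s 0 st; rewrite normr0 scale0r addr0.
  by move=> /(_ (normr_ge0 _))/rP[].
have [s st Es] : exists2 s : R, `|s| <= `|t| &
    F (y + t *: v) - F y = t * 'D_v F (y + s *: v).
  by apply: MVT_line => s /dF[].
have [s' s't Es'] : exists2 s' : R, `|s'| <= `|t| &
    'D_v f (y + s *: v + t *: u) - 'D_v f (y + s *: v) =
    t * 'D_u ('D_v f) (y + s *: v + s' *: u).
  apply: (@MVT_line _ _ ('D_v f) (y + s *: v) u t) => s' s't.
  apply: (smooth_derivable oO sDf).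
  by have [] := rP _ (small _ _ st s't).
have -> : second_difference f y (t *: u) (t *: v) = F (y + t *: v) - F y.
  rewrite /second_difference /F -!addrA [t *: v + _]addrC; ring.
rewrite Es (@derive_val _ _ _ _ _ _ _ (dF s st)) Es'.
rewrite mulrA -expr2 mulrAC divff ?expf_neq0// mul1r.
by have [] := rP _ (small _ _ st s't).
Unshelve. all: by end_near. Qed.

Lemma schwarz O f y u v : open O -> smooth_fun O f -> O y ->
  'D_u ('D_v f) y = 'D_v ('D_u f) y.
Proof.
move=> oO sf Oy; apply/eqP; rewrite -subr_eq0 -normr_le0.
apply/ler_addgt0Pr => e e0; rewrite add0r.
have e20 : 0 < e / 2 by rewrite divr_gt0.
have [d1 d10 H1] := second_difference_near u v oO sf Oy e20.
have [d2 d20 H2] := second_difference_near v u oO sf Oy e20.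
pose t := Num.min d1 d2 / 2.
have m0 : 0 < Num.min d1 d2 by rewrite lt_min d10.
have t0 : 0 < t by rewrite divr_gt0.
have tm : `|t| < Num.min d1 d2.
  by rewrite gtr0_norm// /t ltr_pdivrMr// mulr_natr mulr2n ltrDl.
have := H2 t; have := H1 t; move: tm; rewrite lt_min => /andP[-> ->].
rewrite gt_eqF// => /(_ isT isT) K1 /(_ isT isT) K2.
have E : second_difference f y (t *: v) (t *: u) =
    second_difference f y (t *: u) (t *: v).
  by rewrite /second_difference [y + t *: v + t *: u]addrAC; ring.
rewrite E in K2; set X := _ / _ in K1 K2; clearbody X.
move: ('D_u ('D_v f) y) ('D_v ('D_u f) y) K1 K2 => D D' K1 K2.
rewrite -(subrKA X) [e]splitr (le_trans (ler_normD _ _))// lerD ?ltW//.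
by rewrite distrC.
Qed.

End Smoothness.

(** * Levi-Civita connection *)

Section PointwiseDerivatives.
Context {R : realType} {V : normedModType R}.
Implicit Types (f g : V -> R) (y u : V) (df dg a : R).

Lemma is_derive_add f g y u df dg : is_derive y u f df -> is_derive y u g dg ->
  is_derive y u (fun z => f z + g z) (df + dg).
Proof. by move=> Hf Hg; exact: is_deriveD. Qed.

Lemma is_derive_opp f y u df : is_derive y u f df ->
  is_derive y u (fun z => - f z) (- df).
Proof. by move=> Hf; exact: is_deriveN. Qed.

Lemma is_derive_mul f g y u df dg : is_derive y u f df -> is_derive y u g dg ->
  is_derive y u (fun z => f z * g z) (f y * dg + g y * df).
Proof. by move=> Hf Hg; exact: is_deriveM. Qed.

Lemma is_derive_scale a f y u df : is_derive y u f df ->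
  is_derive y u (fun z => a * f z) (a * df).
Proof. by move=> Hf; exact: (@is_deriveZ _ _ _ f a y u df Hf). Qed.

Lemma is_derive_inv f y u df : is_derive y u f df -> f y != 0 ->
  is_derive y u (fun z => (f z)^-1) (- (f y)^-1 ^+ 2 * df).
Proof.
move=> [Hf <-] fy0; split; first exact: derivableV.
by rewrite deriveV// exprVn.
Qed.

End PointwiseDerivatives.

Section MatrixSmoothness.
Context {R : realType} {n : nat}.
Implicit Types (O : set 'rV[R]_n).

Lemma smooth_det O m (M : 'rV[R]_n -> 'M[R]_m) : open O ->
  (forall i j, smooth_fun O (fun y => M y i j)) ->
  smooth_fun O (fun y => \det (M y)).
Proof.
move=> oO sM; apply: smooth_sum => // s _; apply: smoothZ => //.
by apply: smooth_prod => // i _.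
Qed.

(** Cramer's rule: each entry is a cofactor divided by the determinant. *)
Lemma smooth_invmx O m (M : 'rV[R]_n -> 'M[R]_m) i j : open O ->
  (forall i j, smooth_fun O (fun y => M y i j)) ->
  (forall y, O y -> M y \in unitmx) ->
  smooth_fun O (fun y => invmx (M y) i j).
Proof.
move=> oO sM uM.
have sdet : smooth_fun O (fun y => (\det (M y))^-1).
  apply: smoothV => //; last exact: smooth_det.
  by move=> y Oy; have := uM y Oy; rewrite unitmxE unitfE.
have scof : smooth_fun O (fun y => cofactor (M y) j i).
  apply: smoothZ => //; apply: smooth_det => // a b.
  apply: smooth_ext (sM (lift j a) (lift i b)) => // y _.
  by rewrite !mxE.
apply: smooth_ext (smoothM oO sdet scof) => // y Oy.
by rewrite /invmx uM// !mxE.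
Qed.

Lemma is_derive_sumr (V : normedModType R) (y u : V) (I : Type) (r : seq I)
    (P : pred I) (F : I -> V -> R) (dF : I -> R) :
  (forall i, P i -> is_derive y u (F i) (dF i)) ->
  is_derive y u (fun z => \sum_(i <- r | P i) F i z) (\sum_(i <- r | P i) dF i).
Proof.
move=> H; elim: r => [|i r IH].
  rewrite big_nil; have -> : (fun z => \sum_(i <- [::] | P i) F i z) = cst 0.
    by apply/funext => z; rewrite big_nil.
  exact: is_derive_cst.
have [Pi|nPi] := boolP (P i).
  rewrite big_cons Pi.
  have -> : (fun z => \sum_(j <- i :: r | P j) F j z) =
      F i + (fun z => \sum_(j <- r | P j) F j z).
    by apply/funext => z; rewrite big_cons Pi.
  by apply: is_deriveD => //; exact: H.
rewrite big_cons (negbTE nPi).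
have -> // : (fun z => \sum_(j <- i :: r | P j) F j z) =
    (fun z => \sum_(j <- r | P j) F j z).
by apply/funext => z; rewrite big_cons (negbTE nPi).
Qed.

End MatrixSmoothness.

Section Bilinear.
Context {R : realType} {n : nat}.
Implicit Types (u v w : 'rV[R]_n) (g : 'M[R]_n).

Lemma ipE g u v : ip g u v = \sum_(i < n) \sum_(j < n) u 0 i * v 0 j * g i j.
Proof.
rewrite /ip mxE; under eq_bigr => j _ do rewrite !mxE mulr_suml.
rewrite exchange_big /=; apply: eq_bigr => i _; apply: eq_bigr => j _.
by rewrite mulrAC.
Qed.

Lemma dotE u v : dot u v = \sum_(i < n) u 0 i * v 0 i.
Proof. by rewrite /dot mxE; apply: eq_bigr => i _; rewrite mxE. Qed.

Lemma ipC g u v : g^T = g -> ip g u v = ip g v u.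
Proof.
move=> gT; rewrite !ipE exchange_big /=; apply: eq_bigr => i _.
by apply: eq_bigr => j _; rewrite -[in RHS]gT mxE [in RHS]mulrAC mulrAC [u 0 j * _]mulrC.
Qed.

Lemma ipDl g u v w : ip g (u + v) w = ip g u w + ip g v w.
Proof. by rewrite /ip !mulmxDl mxE. Qed.

Lemma ipZl g (a : R) u w : ip g (a *: u) w = a * ip g u w.
Proof. by rewrite /ip -!scalemxAl mxE. Qed.

Lemma ip_suml g (I : Type) (r : seq I) (P : pred I) (F : I -> 'rV[R]_n) w :
  ip g (\sum_(i <- r | P i) F i) w = \sum_(i <- r | P i) ip g (F i) w.
Proof.
elim/big_rec2 : _ => [|i a b _ <-]; first by rewrite /ip !mul0mx mxE.
exact: ipDl.
Qed.

Lemma ipBl g u v w : ip g (u - v) w = ip g u w - ip g v w.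
Proof. by rewrite ipDl -scaleN1r ipZl mulN1r. Qed.

Lemma ipZr g (a : R) u w : ip g u (a *: w) = a * ip g u w.
Proof. by rewrite /ip linearZ /= -scalemxAr mxE. Qed.

Lemma ip_unitmx g : (forall u, u != 0 -> 0 < ip g u u) -> g \in unitmx.
Proof.
move=> gpos; rewrite -row_free_unit -kermx_eq0; apply/rowV0P => v /sub_kermxP vg.
apply/eqP; apply: contraT => /gpos; by rewrite /ip vg mul0mx mxE ltxx.
Qed.

End Bilinear.

Section LeviCivita.
Context {R : realType} {n : nat}.
Variables (O : set 'rV[R]_n) (G : 'rV[R]_n -> 'M[R]_n).
Hypothesis oO : open O.
Hypothesis sG : forall i j, smooth_fun O (fun y => G y i j).
Hypothesis symG : forall y, O y -> (G y)^T = G y.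
Hypothesis uG : forall y, O y -> G y \in unitmx.
Implicit Types y u v w z : 'rV[R]_n.

Lemma smooth_christoffel i j l : smooth_fun O (fun y => christoffel G y i j l).
Proof.
apply: smoothZ => //; apply: smooth_sum => // r _; apply: smoothM => //.
  exact: smooth_invmx.
apply: smoothB => //; last by apply: smooth_derive.
by apply: smoothD => //; apply: smooth_derive.
Qed.

(** The covariant derivative of the constant field [w]. Since [curvature] is evaluated on constant
    fields, [chr] and its first derivatives determine it. *)
Definition chr u w y : 'rV[R]_n :=
  \row_l \sum_(i < n) \sum_(j < n) u 0 i * w 0 j * christoffel G y i j l.

Lemma covE u Y y : cov G u Y y = 'D_u Y y + chr u (Y y) y.
Proof. by []. Qed.

Lemma cov_cst u w : cov G u (cst w) = chr u w.
Proof. by apply/funext => y; rewrite covE derive_cst add0r. Qed.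

Lemma smooth_chr u w l : smooth_fun O (fun y => chr u w y 0 l).
Proof.
have S := @smooth_sum _ _ O 'I_n (index_enum 'I_n) xpredT (fun i y =>
  \sum_(j < n) u 0 i * w 0 j * christoffel G y i j l) oO.
apply: (smooth_ext oO _ (S _)); first by move=> y _; rewrite mxE.
move=> i _; apply: smooth_sum => // j _; apply: smoothZ => //.
exact: smooth_christoffel.
Qed.

Lemma derivable_chr u v w y : O y -> derivable (chr v w) y u.
Proof.
move=> Oy; apply/derivable_mxP => i l; rewrite ord1.
exact: (smooth_derivable oO (smooth_chr v w l)).
Qed.

Lemma ip_derive u v w y : O y ->
  'D_u (fun z => ip (G z) v w) y =
  \sum_(k < n) u 0 k *
    \sum_(i < n) \sum_(j < n) v 0 i * w 0 j * 'D_(delta_mx 0 k) (fun z => G z i j) y.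
Proof.
move=> Oy.
have -> : (fun z => ip (G z) v w) =
    (fun z => \sum_(i < n) \sum_(j < n) v 0 i * w 0 j * G z i j).
  by apply/funext => z; rewrite ipE.
have D i j := smooth_is_derive oO (sG i j) u Oy.
have -> : 'D_u (fun z => \sum_(i < n) \sum_(j < n) v 0 i * w 0 j * G z i j) y =
   \sum_(i < n) \sum_(j < n) v 0 i * w 0 j * 'D_u (fun z => G z i j) y.
  apply: (@derive_val _ _ _ y u).
  by do 2![apply: is_derive_sumr => ? _]; exact/is_derive_scale/D.
transitivity (\sum_(i < n) \sum_(j < n) \sum_(k < n)
    u 0 k * (v 0 i * w 0 j * 'D_(delta_mx 0 k) (fun z => G z i j) y)).
  apply: eq_bigr => i _; apply: eq_bigr => j _.
  rewrite (smooth_deriveE oO (sG i j))// mulr_sumr; apply: eq_bigr => k _.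
  by rewrite mulrCA.
under eq_bigr => i _ do rewrite exchange_big.
rewrite exchange_big /=; apply: eq_bigr => k _; rewrite mulr_sumr.
by apply: eq_bigr => i _; rewrite mulr_sumr.
Qed.

Lemma christoffel_lower y i j k : O y ->
  \sum_(l < n) christoffel G y i j l * G y l k =
  2^-1 * ('D_(delta_mx 0 i) (fun z => G z j k) y +
     'D_(delta_mx 0 j) (fun z => G z i k) y -
     'D_(delta_mx 0 k) (fun z => G z i j) y).
Proof.
move=> Oy; pose c r := 'D_(delta_mx 0 i) (fun z => G z j r) y +
     'D_(delta_mx 0 j) (fun z => G z i r) y -
     'D_(delta_mx 0 r) (fun z => G z i j) y.
rewrite -[X in _ = _ * X]/(c k).
transitivity (2^-1 * \sum_(r < n) c r * (\sum_(l < n) G y k l * invmx (G y) l r)).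
  under eq_bigr => l _ do rewrite /christoffel -mulrA mulr_suml.
  rewrite -mulr_sumr exchange_big /=; congr (_ * _); apply: eq_bigr => r _.
  rewrite mulr_sumr; apply: eq_bigr => l _.
  have -> : G y l k = G y k l by rewrite -{1}(symG Oy) mxE.
  by rewrite /c; ring.
congr (_ * _).
transitivity (\sum_(r < n) c r * (1%:M : 'M[R]_n) k r).
  by apply: eq_bigr => r _; rewrite -(mulmxV (uG Oy)) [in RHS]mxE.
rewrite (bigD1 k)//= big1 ?addr0 => [|r rk].
  by rewrite !mxE eqxx mulr1.
by rewrite !mxE eq_sym (negbTE rk) mulr0.
Qed.

(** Constant fields commute, so the bracket terms of the Koszul formula are absent. *)
Lemma koszul u v w y : O y ->
  ip (G y) (chr u v y) w = 2^-1 * ('D_u (fun z => ip (G z) v w) y +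
    'D_v (fun z => ip (G z) u w) y - 'D_w (fun z => ip (G z) u v) y).
Proof.
move=> Oy; rewrite !ip_derive//.
transitivity (\sum_(i < n) \sum_(j < n) \sum_(k < n)
    u 0 i * v 0 j * w 0 k * (\sum_(l < n) christoffel G y i j l * G y l k)).
  rewrite ipE.
  transitivity (\sum_(l < n) \sum_(k < n) \sum_(i < n) \sum_(j < n)
      u 0 i * v 0 j * w 0 k * (christoffel G y i j l * G y l k)).
    apply: eq_bigr => l _; apply: eq_bigr => k _; rewrite mxE !mulr_suml.
    apply: eq_bigr => i _; rewrite !mulr_suml; apply: eq_bigr => j _; ring.
  under eq_bigr => l _ do rewrite exchange_big.
  rewrite exchange_big; apply: eq_bigr => i _ /=.
  under eq_bigr => l _ do rewrite exchange_big.
  rewrite exchange_big; apply: eq_bigr => j _ /=.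
  rewrite exchange_big; apply: eq_bigr => k _ /=.
  by rewrite mulr_sumr.
have E1 : \sum_(k < n) v 0 k * (\sum_(i < n) \sum_(j < n) u 0 i * w 0 j *
      'D_(delta_mx 0 k) (fun z => G z i j) y) =
   \sum_(i < n) \sum_(k < n) \sum_(j < n) u 0 i * v 0 k * w 0 j *
      'D_(delta_mx 0 k) (fun z => G z i j) y.
  under eq_bigr => k _ do rewrite mulr_sumr.
  rewrite exchange_big /=; apply: eq_bigr => i _; apply: eq_bigr => k _.
  by rewrite mulr_sumr; apply: eq_bigr => j _; ring.
have E2 : \sum_(k < n) w 0 k * (\sum_(i < n) \sum_(j < n) u 0 i * v 0 j *
      'D_(delta_mx 0 k) (fun z => G z i j) y) =
   \sum_(i < n) \sum_(j < n) \sum_(k < n) u 0 i * v 0 j * w 0 k *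
      'D_(delta_mx 0 k) (fun z => G z i j) y.
  under eq_bigr => k _ do rewrite mulr_sumr.
  rewrite exchange_big /=; apply: eq_bigr => i _.
  under eq_bigr => k _ do rewrite mulr_sumr.
  rewrite exchange_big /=; apply: eq_bigr => j _.
  by apply: eq_bigr => k _; ring.
rewrite E1 E2 -big_split -sumrB mulr_sumr; apply: eq_bigr => i _ /=.
rewrite mulr_sumr -big_split -sumrB mulr_sumr; apply: eq_bigr => j _ /=.
rewrite mulr_sumr -big_split -sumrB mulr_sumr; apply: eq_bigr => k _ /=.
by rewrite christoffel_lower//; ring.
Qed.

Lemma curvatureE u v w y : curvature G u v w y =
  'D_u (chr v w) y + chr u (chr v w y) y -
  ('D_v (chr u w) y + chr v (chr u w y) y).
Proof. by rewrite /curvature !cov_cst !covE. Qed.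

End LeviCivita.

(** * Curvature in the Gibbons-Hawking frame *)

Lemma sum_I2 (V : nmodType) (F : 'I_2 -> V) : \sum_(a < 2) F a = F 0 + F 1.
Proof.
rewrite 2!big_ord_recl big_ord0 addr0.
by congr (F _ + F _); exact: val_inj.
Qed.

Section FrameAlgebra.
Context {R : realType}.
Implicit Types (a b p : 'I_4 -> R) (h : R) (j : 'I_4).

Lemma I4_ind (P : 'I_4 -> Prop) : P 0 -> P 1 -> P 2 -> P 3 -> forall j, P j.
Proof.
move=> P0 P1 P2 P3; case=> -[|[|[|[|//]]]] j4.
- by rewrite (_ : Ordinal j4 = 0)//; exact: val_inj.
- by rewrite (_ : Ordinal j4 = 1)//; exact: val_inj.
- by rewrite (_ : Ordinal j4 = 2)//; exact: val_inj.
- by rewrite (_ : Ordinal j4 = 3)//; exact: val_inj.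
Qed.

(* Index 0 is the fibre direction; 1, 2, 3 are the directions of R^3. *)
Definition dot3 a b : R := a 1 * b 1 + a 2 * b 2 + a 3 * b 3.

Definition det3 a b p : R :=
  (a 2 * b 3 - a 3 * b 2) * p 1 + (a 3 * b 1 - a 1 * b 3) * p 2 +
  (a 1 * b 2 - a 2 * b 1) * p 3.

Definition cross3 a b j : R :=
  match val j with
  | 0%N => 0
  | 1%N => a 2 * b 3 - a 3 * b 2
  | 2%N => a 3 * b 1 - a 1 * b 3
  | _ => a 1 * b 2 - a 2 * b 1
  end.

(* Christoffel symbols of h theta_0^2 + h^-1 (theta_1^2 + theta_2^2 + theta_3^2)
   in the frame dual to theta, where d(h^-1) = p, d(theta_0) = *p and
   d(theta_i) = 0 for i > 0. *)
Definition gam h p a b j : R :=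
  if val j == 0%N then - (h / 2) * (a 0 * dot3 b p + b 0 * dot3 a p) - det3 a b p / 2
  else h ^+ 3 / 2 * (a 0 * b 0 * p j)
    - h ^+ 2 / 2 * (a 0 * cross3 b p j + b 0 * cross3 a p j)
    + h / 2 * (dot3 a p * b j + dot3 b p * a j - dot3 a b * p j).

Definition dgam_dh h p a b j : R :=
  if val j == 0%N then - 2^-1 * (a 0 * dot3 b p + b 0 * dot3 a p)
  else 3 / 2 * h ^+ 2 * (a 0 * b 0 * p j)
    - h * (a 0 * cross3 b p j + b 0 * cross3 a p j)
    + 2^-1 * (dot3 a p * b j + dot3 b p * a j - dot3 a b * p j).

Definition ipf h f a b : R := h * (a 0 * b 0) + f * dot3 a b.

Lemma gamDl h p a a' b j :
  gam h p (fun i => a i + a' i) b j = gam h p a b j + gam h p a' b j.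
Proof.
by elim/I4_ind : j; rewrite /gam /= /cross3 /dot3 /det3 /=; ring.
Qed.

Lemma gamDr h p a b b' j :
  gam h p a (fun i => b i + b' i) j = gam h p a b j + gam h p a b' j.
Proof.
by elim/I4_ind : j; rewrite /gam /= /cross3 /dot3 /det3 /=; ring.
Qed.

(** [gam] is linear in each of [p], [a] and [b], so the product rule just substitutes their
    derivatives; only the dependence on [h] needs a formula of its own, [dgam_dh]. *)
Lemma is_derive_gam (V : normedModType R) (y u : V) (h : V -> R)
    (p a b : 'I_4 -> V -> R) dh (dp da db : 'I_4 -> R) j :
  is_derive y u h dh -> (forall i, is_derive y u (p i) (dp i)) ->
  (forall i, is_derive y u (a i) (da i)) ->
  (forall i, is_derive y u (b i) (db i)) ->
  is_derive y u (fun z => gam (h z) (p^~ z) (a^~ z) (b^~ z) j)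
    (gam (h y) (p^~ y) da (b^~ y) j + gam (h y) (p^~ y) (a^~ y) db j +
     (dh * dgam_dh (h y) (p^~ y) (a^~ y) (b^~ y) j +
      gam (h y) dp (a^~ y) (b^~ y) j)).
Proof.
move=> Hh Hp Ha Hb.
by elim/I4_ind : j; rewrite /gam /dgam_dh /cross3 /dot3 /det3 /=;
  apply: is_derive_eq; rewrite /GRing.scale /=; field.
Qed.

(* The frame components of R(u, v)w, where dh is the differential of h and q u
   is the derivative of p along u. *)
Definition curv_frame h (dh : ('I_4 -> R) -> R) p
    (q : ('I_4 -> R) -> 'I_4 -> R) (u v w : 'I_4 -> R) j : R :=
  gam h p (fun i => if val i == 0%N then det3 u v p else 0) w j
  + (dh u * dgam_dh h p v w j + gam h (q u) v w j)
  - (dh v * dgam_dh h p u w j + gam h (q v) u w j)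
  + gam h p u (gam h p v w) j - gam h p v (gam h p u w) j.

(** Leibniz expansion of the derivative of [ipf f^-1 f b d] along [a], where [Sb] and [Sd] are the
    derivatives of the components of [b] and [d]. *)
Definition dipf f p a b d (Sb Sd : 'I_4 -> R) : R :=
  - f^-1 ^+ 2 * dot3 a p * (b 0 * d 0) + f^-1 * (Sb 0 * d 0 + b 0 * Sd 0)
  + dot3 a p * dot3 b d + f * (dot3 Sb d + dot3 b Sd).

Lemma is_derive_ipf (V : normedModType R) (y u : V) (f : V -> R)
    (b d : 'I_4 -> V -> R) (p a Sb Sd : 'I_4 -> R) :
  f y != 0 -> is_derive y u f (dot3 a p) ->
  (forall i, is_derive y u (b i) (Sb i)) ->
  (forall i, is_derive y u (d i) (Sd i)) ->
  is_derive y u (fun z => ipf (f z)^-1 (f z) (b^~ z) (d^~ z))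
    (dipf (f y) p a (b^~ y) (d^~ y) Sb Sd).
Proof.
move=> f0; rewrite /ipf /dipf; move: (dot3 a p) => df Hf Hb Hd.
have Hi := is_derive_inv Hf f0; rewrite /dot3.
by apply: is_derive_eq; rewrite /GRing.scale /=; ring.
Qed.

(** [Sab] stands for the derivative along [a] of the components of [b]. The structure equations fix
    the antisymmetric part of each pair; after substituting them, the derivatives of the components
    of [d] cancel and only [Sab] survives. *)
Lemma koszul_frame f p a b d (Sab Sba Sad Sda Sbd Sdb : 'I_4 -> R) : f != 0 ->
  (forall j, Sab j - Sba j = if val j == 0%N then det3 a b p else 0) ->
  (forall j, Sad j - Sda j = if val j == 0%N then det3 a d p else 0) ->
  (forall j, Sbd j - Sdb j = if val j == 0%N then det3 b d p else 0) ->
  2^-1 * (dipf f p a b d Sab Sad + dipf f p b a d Sba Sbd - dipf f p d a b Sda Sdb)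
  = ipf f^-1 f (fun j => Sab j + gam f^-1 p a b j) d.
Proof.
move=> f0 Hab Had Hbd.
have Eab j : Sba j = Sab j - (if val j == 0%N then det3 a b p else 0).
  by rewrite -Hab subKr.
have Ead j : Sda j = Sad j - (if val j == 0%N then det3 a d p else 0).
  by rewrite -Had subKr.
have Ebd j : Sdb j = Sbd j - (if val j == 0%N then det3 b d p else 0).
  by rewrite -Hbd subKr.
rewrite /dipf /ipf /gam /dot3 /cross3 /= !Eab !Ead !Ebd /= /det3; field.
exact: f0.
Qed.

Section Sectional.
Variables (f : R) (p : 'I_4 -> R) (H : 'I_4 -> 'I_4 -> R) (e v : 'I_4 -> R).
Hypotheses (f0 : f != 0) (symH : forall i j, H i j = H j i).
Hypothesis traceH : H 1 1 + H 2 2 + H 3 3 = 0.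
Hypotheses (e2 : e 2 = 0) (e3 : e 3 = 0) (v0 : v 0 = 0) (v1 : v 1 = 0).

Let h := f^-1.
Let dh (u : 'I_4 -> R) := - h ^+ 2 * dot3 u p.
Let q (u : 'I_4 -> R) j := dot3 u (H^~ j).

Lemma curv_frame_sectional0 : curv_frame h dh p q e v v 0 =
  e 0 * (h * (H 2 3 * v 2 * v 3 + H 2 2 * (v 2 ^+ 2 - v 3 ^+ 2) / 2
              - H 1 1 * v 3 ^+ 2 / 2)
         + h ^+ 2 * (p 3 ^+ 2 * (v 2 ^+ 2 / 2 - v 3 ^+ 2) - 3 * p 2 * p 3 * v 2 * v 3
                     + p 2 ^+ 2 * (v 3 ^+ 2 / 2 - v 2 ^+ 2)
                     + p 1 ^+ 2 * (v 2 ^+ 2 + v 3 ^+ 2) / 2))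
  + e 1 * (H 2 3 * (v 2 ^+ 2 - v 3 ^+ 2) / 2 - H 2 2 * v 2 * v 3
           - H 1 1 * v 2 * v 3 / 2
           + 3 / 2 * h * ((p 2 ^+ 2 - p 3 ^+ 2) * v 2 * v 3
                          + p 2 * p 3 * (v 3 ^+ 2 - v 2 ^+ 2))).
Proof.
have H33 : H 3 3 = - H 1 1 - H 2 2.
  by apply/eqP; rewrite -subr_eq0 -traceH; apply/eqP; ring.
have H21 := symH 2 1; have H31 := symH 3 1; have H32 := symH 3 2.
rewrite /curv_frame /gam /dgam_dh /dot3 /det3 /cross3 /q /dh /dot3.
by rewrite /= e2 e3 v0 v1 H33 H21 H31 H32 /h; field.
Qed.

Lemma curv_frame_sectional1 : curv_frame h dh p q e v v 1 =
  e 1 * (h * (- H 2 3 * v 2 * v 3 + H 2 2 * (v 3 ^+ 2 - v 2 ^+ 2) / 2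
              - H 1 1 * v 2 ^+ 2 / 2)
         + h ^+ 2 * (p 3 ^+ 2 * (v 3 ^+ 2 / 2 - v 2 ^+ 2) + 3 * p 2 * p 3 * v 2 * v 3
                     + p 2 ^+ 2 * (v 2 ^+ 2 / 2 - v 3 ^+ 2)
                     + p 1 ^+ 2 * (v 2 ^+ 2 + v 3 ^+ 2) / 2))
  + e 0 * h ^+ 2 * (H 2 3 * (v 2 ^+ 2 - v 3 ^+ 2) / 2 - H 2 2 * v 2 * v 3
           - H 1 1 * v 2 * v 3 / 2
           + 3 / 2 * h * ((p 2 ^+ 2 - p 3 ^+ 2) * v 2 * v 3
                          + p 2 * p 3 * (v 3 ^+ 2 - v 2 ^+ 2))).
Proof.
have H33 : H 3 3 = - H 1 1 - H 2 2.
  by apply/eqP; rewrite -subr_eq0 -traceH; apply/eqP; ring.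
have H21 := symH 2 1; have H31 := symH 3 1; have H32 := symH 3 2.
rewrite /curv_frame /gam /dgam_dh /dot3 /det3 /cross3 /q /dh /dot3.
by rewrite /= e2 e3 v0 v1 H33 H21 H31 H32 /h; field.
Qed.

End Sectional.

(* Entries of M^T M = diag(f, h), deduced from M diag(h, f) M^T = 1. *)
Lemma gram_rows (f : R) (s t : 'I_2 -> R) : 0 < f ->
  (forall a b : 'I_2, f^-1 * (s a * s b) + f * (t a * t b) = (a == b)%:R) ->
  [/\ s 0 ^+ 2 + s 1 ^+ 2 = f, t 0 ^+ 2 + t 1 ^+ 2 = f^-1 &
      s 0 * t 0 + s 1 * t 1 = 0].
Proof.
move=> f_gt0 E; have f0 : f != 0 by rewrite gt_eqF.
pose A : 'M[R]_2 := \matrix_(i, j) (if j == 0 then s i else f * t i).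
pose B : 'M[R]_2 := \matrix_(j, i) (if j == 0 then f^-1 * s i else t i).
have AB : A *m B = 1%:M.
  apply/matrixP => a b; rewrite !mxE sum_I2 !mxE /= -E; ring.
have /matrixP BA := mulmx1C AB.
have E00 : f^-1 * s 0 * s 0 + f^-1 * s 1 * s 1 = 1.
  by have := BA 0 0; rewrite !mxE sum_I2 !mxE.
have E01 : f^-1 * s 0 * (f * t 0) + f^-1 * s 1 * (f * t 1) = 0.
  by have := BA 0 1; rewrite !mxE sum_I2 !mxE.
have E11 : t 0 * (f * t 0) + t 1 * (f * t 1) = 1.
  by have := BA 1 1; rewrite !mxE sum_I2 !mxE.
split.
- by rewrite -[f in RHS]mulr1 -E00; field.
- by rewrite -[f^-1]mulr1 -E11; field.
- by rewrite -E01; field.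
Qed.

Section FrameStability.
Variables (f : R) (p : 'I_4 -> R) (H : 'I_4 -> 'I_4 -> R).
Variables (e : 'I_2 -> 'I_4 -> R) (v : 'I_4 -> R).
Hypotheses (f_gt0 : 0 < f) (symH : forall i j, H i j = H j i).
Hypothesis traceH : H 1 1 + H 2 2 + H 3 3 = 0.
Hypotheses (e2 : forall k, e k 2 = 0) (e3 : forall k, e k 3 = 0).
Hypotheses (v0 : v 0 = 0) (v1 : v 1 = 0).

Let h := f^-1.
Let dh (u : 'I_4 -> R) := - h ^+ 2 * dot3 u p.
Let q (u : 'I_4 -> R) j := dot3 u (H^~ j).
Hypothesis orth : forall a b : 'I_2, ipf h f (e a) (e b) = (a == b)%:R.

(* The right-hand side is the Gauss curvature of h theta_0^2 + f theta_1^2. *)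
Lemma frame_stability :
  - (\sum_(a < 2) ipf h f (curv_frame h dh p q (e a) v v) (e a))
  - \sum_(a < 2) \sum_(b < 2) ipf h f (gam h p (e a) (e b)) v ^+ 2
  = (f * H 1 1 - 2 * p 1 ^+ 2) / (2 * f ^+ 3) * ipf h f v v.
Proof.
have f0 : f != 0 by rewrite gt_eqF.
have [S T ST] : [/\ e 0 0 ^+ 2 + e 1 0 ^+ 2 = f, e 0 1 ^+ 2 + e 1 1 ^+ 2 = f^-1 &
    e 0 0 * e 0 1 + e 1 0 * e 1 1 = 0].
  have G := @gram_rows f (fun k => e k 0) (fun k => e k 1) f_gt0.
  move: G => /=; apply => a b; by rewrite -orth /ipf /dot3 !e2 !e3 !mul0r !addr0.
pose A0 := h * (H 2 3 * v 2 * v 3 + H 2 2 * (v 2 ^+ 2 - v 3 ^+ 2) / 2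
              - H 1 1 * v 3 ^+ 2 / 2)
         + h ^+ 2 * (p 3 ^+ 2 * (v 2 ^+ 2 / 2 - v 3 ^+ 2) - 3 * p 2 * p 3 * v 2 * v 3
                     + p 2 ^+ 2 * (v 3 ^+ 2 / 2 - v 2 ^+ 2)
                     + p 1 ^+ 2 * (v 2 ^+ 2 + v 3 ^+ 2) / 2).
pose A1 := h * (- H 2 3 * v 2 * v 3 + H 2 2 * (v 3 ^+ 2 - v 2 ^+ 2) / 2
              - H 1 1 * v 2 ^+ 2 / 2)
         + h ^+ 2 * (p 3 ^+ 2 * (v 3 ^+ 2 / 2 - v 2 ^+ 2) + 3 * p 2 * p 3 * v 2 * v 3
                     + p 2 ^+ 2 * (v 2 ^+ 2 / 2 - v 3 ^+ 2)
                     + p 1 ^+ 2 * (v 2 ^+ 2 + v 3 ^+ 2) / 2).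
pose B := H 2 3 * (v 2 ^+ 2 - v 3 ^+ 2) / 2 - H 2 2 * v 2 * v 3
           - H 1 1 * v 2 * v 3 / 2
           + 3 / 2 * h * ((p 2 ^+ 2 - p 3 ^+ 2) * v 2 * v 3
                          + p 2 * p 3 * (v 3 ^+ 2 - v 2 ^+ 2)).
have sec (a : 'I_2) : ipf h f (curv_frame h dh p q (e a) v v) (e a) =
    e a 0 ^+ 2 * (h * A0) + e a 0 * e a 1 * (2 * h * B) + e a 1 ^+ 2 * (f * A1).
  rewrite /ipf /dot3 !e2 !e3 !mulr0 !addr0.
  rewrite (curv_frame_sectional0 p f0 symH traceH (e2 a) (e3 a) v0 v1).
  rewrite (curv_frame_sectional1 p f0 symH traceH (e2 a) (e3 a) v0 v1).
  by rewrite -/h -/A0 -/A1 -/B /h; field.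
(* In the normal plane, [P] pairs [v] with the gradient and [Q] pairs it with the gradient rotated
   by a quarter turn. *)
pose P := p 2 * v 2 + p 3 * v 3; pose Q := p 3 * v 2 - p 2 * v 3.
have sff (a b : 'I_2) : ipf h f (gam h p (e a) (e b)) v =
    h ^+ 2 / 2 * P * (e a 0 * e b 0) + h / 2 * Q * (e a 0 * e b 1 + e a 1 * e b 0)
    - P / 2 * (e a 1 * e b 1).
  rewrite /ipf /gam /dot3 /det3 /cross3 /= v0 v1 !e2 !e3 /P /Q /h; field.
  exact: f0.
have sumsq (x y z : R) (g : 'I_2 -> 'I_2 -> R) :
    (forall a b : 'I_2, g a b = x * (e a 0 * e b 0) + y * (e a 0 * e b 1 + e a 1 * e b 0)
       - z * (e a 1 * e b 1)) ->
    \sum_(a < 2) \sum_(b < 2) g a b ^+ 2 = x ^+ 2 * f ^+ 2 + 2 * y ^+ 2 + z ^+ 2 * h ^+ 2.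
  move=> gE; transitivity (x ^+ 2 * f ^+ 2 + 2 * y ^+ 2 * (f * h) + z ^+ 2 * h ^+ 2);
    last by rewrite /h mulfV// mulr1.
  rewrite -/h in T; rewrite -S -T.
  (* The last summand is a multiple of the sum that vanishes by [ST]; its cofactor is chosen to make
     the goal a polynomial identity in the entries of [e]. *)
  transitivity (x ^+ 2 * (e 0 0 ^+ 2 + e 1 0 ^+ 2) ^+ 2
    + 2 * y ^+ 2 * ((e 0 0 ^+ 2 + e 1 0 ^+ 2) * (e 0 1 ^+ 2 + e 1 1 ^+ 2))
    + z ^+ 2 * (e 0 1 ^+ 2 + e 1 1 ^+ 2) ^+ 2
    + (e 0 0 * e 0 1 + e 1 0 * e 1 1) *
      (2 * y ^+ 2 * (e 0 0 * e 0 1 + e 1 0 * e 1 1)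
       + 4 * x * y * (e 0 0 ^+ 2 + e 1 0 ^+ 2)
       - 2 * x * z * (e 0 0 * e 0 1 + e 1 0 * e 1 1)
       - 4 * y * z * (e 0 1 ^+ 2 + e 1 1 ^+ 2))); last first.
    by rewrite ST mul0r addr0.
  by rewrite !sum_I2 !gE; ring.
(* The mixed coefficient [B] is multiplied by the sum in [ST] and drops out. *)
have sumsec : \sum_(a < 2) ipf h f (curv_frame h dh p q (e a) v v) (e a) = A0 + A1.
  under eq_bigr => a _ do rewrite sec.
  rewrite !big_split -!mulr_suml /=.
  by rewrite !sum_I2 S T ST /h; field.
(* Since [P^2 + Q^2] is the product of [p 2 ^+ 2 + p 3 ^+ 2] and [v 2 ^+ 2 + v 3 ^+ 2], the normal
   gradient cancels between the two sums, and only [p 1] and [H 1 1] remain. *)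
rewrite sumsec (sumsq _ _ _ _ sff) /A0 /A1 /P /Q /h /ipf /dot3 v0 v1; field.
exact: f0.
Qed.
End FrameStability.
End FrameAlgebra.

(** * From coordinates to coframe components *)

Section LocalFrame.
Context {R : realType}.
Variables (O : set 'rV[R]_4) (G : 'rV[R]_4 -> 'M[R]_4).
Variables (c : 'I_4 -> 'rV[R]_4 -> 'rV[R]_4) (phi : 'rV[R]_4 -> R).
Variables (p : 'I_4 -> 'rV[R]_4 -> R) (H : 'I_4 -> 'I_4 -> 'rV[R]_4 -> R).
Implicit Types (y u v w z : 'rV[R]_4) (j : 'I_4).

(** Components of the constant field [u] in the coframe; the antisymmetric part of their derivatives
    is what the structure equations prescribe. *)
Definition hat u y j : R := dot (c j y) u.

Hypothesis oO : open O.
Hypothesis sG : forall i j, smooth_fun O (fun y => G y i j).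
Hypothesis symG : forall y, O y -> (G y)^T = G y.
Hypothesis posG : forall y u, O y -> u != 0 -> 0 < ip (G y) u u.
Hypothesis sc : forall j i, smooth_fun O (fun y => c j y 0 i).
Hypothesis phi_gt0 : forall y, O y -> 0 < phi y.
Hypothesis dphi : forall y u, O y ->
  is_derive y u phi (dot3 (hat u y) (p^~ y)).
Hypothesis dp : forall y u j, O y ->
  is_derive y u (p j) (dot3 (hat u y) (fun k => H k j y)).
Hypothesis metricE : forall y u v, O y ->
  ip (G y) u v = ipf (phi y)^-1 (phi y) (hat u y) (hat v y).
Hypothesis structure : forall y u v j, O y ->
  'D_u (fun z => hat v z j) y - 'D_v (fun z => hat u z j) y =
  if val j == 0%N then det3 (hat u y) (hat v y) (p^~ y) else 0.

Let uG y : O y -> G y \in unitmx.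
Proof. by move=> Oy; apply: ip_unitmx => u; exact: posG. Qed.

Definition dhat u v y j : R := 'D_u (fun z => hat v z j) y.

Lemma smooth_hat u j : smooth_fun O (fun y => hat u y j).
Proof.
have S := @smooth_sum _ _ O 'I_4 (index_enum 'I_4) xpredT
  (fun i y => u 0 i * c j y 0 i) oO.
apply: (smooth_ext oO _ (S _)).
  by move=> y _; rewrite /hat dotE; apply: eq_bigr => i _; rewrite mulrC.
by move=> i _; apply: smoothZ.
Qed.

Lemma is_derive_hat y u v j : O y ->
  is_derive y u (fun z => hat v z j) (dhat u v y j).
Proof. exact: (smooth_is_derive oO (smooth_hat v j)). Qed.

Lemma hat_lin (a : R) u v y j : hat (a *: u + v) y j = a * hat u y j + hat v y j.
Proof.
rewrite /hat !dotE mulr_sumr -big_split /=; apply: eq_bigr => i _.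
by rewrite !mxE; ring.
Qed.

Lemma hatB u v y j : hat (u - v) y j = hat u y j - hat v y j.
Proof. by rewrite addrC -scaleN1r hat_lin mulN1r addrC. Qed.

Lemma hatD u v y j : hat (u + v) y j = hat u y j + hat v y j.
Proof. by rewrite -[u]scale1r hat_lin mul1r scale1r. Qed.

(** A vector killed by the whole coframe has length zero for the metric, so the coframe is
    invertible. *)
Lemma hat_surj y (x : 'I_4 -> R) : O y ->
  exists z, forall j, hat z y j = x j.
Proof.
move=> Oy; pose T : 'M[R]_4 := \matrix_(i, j) c j y 0 i.
have hatE u j : hat u y j = (u *m T) 0 j.
  by rewrite /hat dotE mxE; apply: eq_bigr => i _; rewrite mxE mulrC.
have uT : T \in unitmx.
  rewrite -row_free_unit -kermx_eq0; apply/rowV0P => u /sub_kermxP uT.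
  apply/eqP; apply: contraT => /(posG Oy).
  have u0 j : hat u y j = 0 by rewrite hatE uT mxE.
  by rewrite metricE// /ipf /dot3 !u0 !(mulr0, addr0) ltxx.
exists ((\row_j x j) *m invmx T) => j.
by rewrite hatE mulmxKV// mxE.
Qed.

Lemma phi_neq0 y : O y -> phi y != 0.
Proof. by move=> Oy; rewrite gt_eqF// phi_gt0. Qed.

Lemma derive_metric y u v w : O y ->
  'D_u (fun z => ip (G z) v w) y =
  dipf (phi y) (p^~ y) (hat u y) (hat v y) (hat w y) (dhat u v y) (dhat u w y).
Proof.
move=> Oy.
have -> : 'D_u (fun z => ip (G z) v w) y =
    'D_u (fun z => ipf (phi z)^-1 (phi z) (hat v z) (hat w z)) y.
  by apply: near_eq_derive; apply: (open_near_eq oO Oy) => z; exact: metricE.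
apply: derive_val; apply: (@is_derive_ipf _ _ y u phi (fun j z => hat v z j)
  (fun j z => hat w z j)) => //.
- exact: phi_neq0.
- exact: dphi.
- by move=> j; exact: is_derive_hat.
- by move=> j; exact: is_derive_hat.
Qed.

(** By the Koszul formula both sides have the same inner product with every vector. Testing against
    the vector whose components are their difference shows that it vanishes. *)
Lemma chr_hat y u v j : O y -> hat (chr G u v y) y j =
  dhat u v y j + gam (phi y)^-1 (p^~ y) (hat u y) (hat v y) j.
Proof.
move=> Oy; have phi0 := phi_neq0 Oy.
pose X j := dhat u v y j + gam (phi y)^-1 (p^~ y) (hat u y) (hat v y) j.
have E z : ipf (phi y)^-1 (phi y) (hat (chr G u v y) y) (hat z y) =
    ipf (phi y)^-1 (phi y) X (hat z y).
  rewrite -metricE// (koszul oO sG symG uG)// !derive_metric//.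
  by apply: koszul_frame => // k; exact: structure.
have [z zE] := hat_surj (fun j => hat (chr G u v y) y j - X j) Oy.
have : ipf (phi y)^-1 (phi y) (hat z y) (hat z y) = 0.
  transitivity (ipf (phi y)^-1 (phi y) (hat (chr G u v y) y) (hat z y) -
    ipf (phi y)^-1 (phi y) X (hat z y)); last by rewrite E subrr.
  by rewrite /ipf /dot3 !zE; ring.
rewrite -metricE// => z0; have {}z0 : z = 0.
  by apply/eqP; apply: contraT => /(posG Oy); rewrite z0 ltxx.
apply/eqP; rewrite -subr_eq0 -[_ - _]zE z0.
by rewrite /hat dotE big1// => i _; rewrite mxE mulr0.
Qed.

(** Product rule: differentiate the field, then the coframe on the field frozen at [Y y]. *)
Lemma derive_hat_field y u (Y : 'rV[R]_4 -> 'rV[R]_4) j : O y ->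
  derivable Y y u ->
  'D_u (fun z => hat (Y z) z j) y = hat ('D_u Y y) y j + dhat u (Y y) y j.
Proof.
move=> Oy dY.
have dYi i : derivable (fun z => Y z 0 i) y u by move/derivable_mxP : dY.
have hatE w z : hat w z j = \sum_(i < 4) c j z 0 i * w 0 i by rewrite /hat dotE.
have D : is_derive y u (fun z => hat (Y z) z j)
    (\sum_(i < 4) (c j y 0 i * 'D_u (fun z => Y z 0 i) y +
                   Y y 0 i * 'D_u (fun z => c j z 0 i) y)).
  under eq_fun => z do rewrite hatE.
  apply: is_derive_sumr => i _; apply: is_derive_mul; last exact: derivableP.
  exact: (smooth_is_derive oO (sc j i)).
rewrite (@derive_val _ _ _ _ _ _ _ D) big_split /=; congr (_ + _).
  by rewrite hatE derive_mx//; apply: eq_bigr => i _; rewrite mxE.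
have D' : is_derive y u (fun z => hat (Y y) z j)
    (\sum_(i < 4) Y y 0 i * 'D_u (fun z => c j z 0 i) y).
  under eq_fun => z do (rewrite hatE; under eq_bigr do rewrite mulrC).
  apply: is_derive_sumr => i _; apply: is_derive_scale.
  exact: (smooth_is_derive oO (sc j i)).
by rewrite /dhat (@derive_val _ _ _ _ _ _ _ D').
Qed.

Definition dframe y (u : 'I_4 -> R) : R := - (phi y)^-1 ^+ 2 * dot3 u (p^~ y).

Definition pframe y (u : 'I_4 -> R) j : R := dot3 u (fun k => H k j y).

Lemma derive_chr_hat y u v w j : O y ->
  hat ('D_u (chr G v w) y) y j = 'D_u (dhat v w ^~ j) y
  + (gam (phi y)^-1 (p^~ y) (dhat u v y) (hat w y) j
     + gam (phi y)^-1 (p^~ y) (hat v y) (dhat u w y) j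
     + (dframe y (hat u y) * dgam_dh (phi y)^-1 (p^~ y) (hat v y) (hat w y) j
        + gam (phi y)^-1 (pframe y (hat u y)) (hat v y) (hat w y) j))
  - dhat u (chr G v w y) y j.
Proof.
move=> Oy.
have dchr : derivable (chr G v w) y u by apply: (derivable_chr oO sG uG).
have -> : hat ('D_u (chr G v w) y) y j =
    'D_u (fun z => hat (chr G v w z) z j) y - dhat u (chr G v w y) y j.
  by rewrite derive_hat_field// addrK.
congr (_ - _).
transitivity ('D_u (fun z => dhat v w z j +
    gam (phi z)^-1 (p^~ z) (hat v z) (hat w z) j) y).
  by apply: near_eq_derive; apply: (open_near_eq oO Oy) => z; exact: chr_hat.
have sdhat : smooth_fun O (dhat v w ^~ j).
  exact: (smooth_derive oO (smooth_hat w j)).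
apply: derive_val; apply: is_derive_add.
  exact: (smooth_is_derive oO sdhat).
apply: (@is_derive_gam _ _ y u (fun z => (phi z)^-1) p
  (fun j z => hat v z j) (fun j z => hat w z j)).
- by apply: is_derive_inv; [exact: dphi|exact: phi_neq0].
- by move=> i; exact: dp.
- by move=> i; exact: is_derive_hat.
- by move=> i; exact: is_derive_hat.
Qed.

(** Second derivatives of the coframe cancel by [schwarz]. First derivatives survive only as
    [dhat u v - dhat v u], which the structure equation turns into the [det3] term, so the result is
    tensorial. *)
Lemma curvature_hat y u v w j : O y ->
  hat (curvature G u v w y) y j =
  curv_frame (phi y)^-1 (dframe y) (p^~ y) (pframe y)
    (hat u y) (hat v y) (hat w y) j.
Proof.
move=> Oy; rewrite curvatureE hatB !hatD !derive_chr_hat// !chr_hat//.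
have -> : 'D_u (dhat v w ^~ j) y = 'D_v (dhat u w ^~ j) y.
  exact: (schwarz _ _ oO (smooth_hat w j) Oy).
have chrE a b : hat (chr G a b y) y =
    (fun j => dhat a b y j + gam (phi y)^-1 (p^~ y) (hat a y) (hat b y) j).
  by apply/funext => i; exact: chr_hat.
have Suv : dhat u v y = (fun i => dhat v u y i +
    (if val i == 0%N then det3 (hat u y) (hat v y) (p^~ y) else 0)).
  by apply/funext => i; rewrite -(structure _ _ _ Oy) addrC subrK.
rewrite !chrE !gamDr Suv gamDl /curv_frame.
by move: (@gam R) (@dgam_dh R) dhat => g dg d; ring.
Qed.

Hypothesis symH : forall y i j, O y -> H i j y = H j i y.
Hypothesis traceH : forall y, O y -> H 1 1 y + H 2 2 y + H 3 3 y = 0.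

(** The vanishing of [dhat] in directions 2 and 3 reflects that tangent vectors keep zero components
    there along the surface; it removes the derivative part of [chr_hat] from the second fundamental
    form. *)
Lemma local_frame_stability y (e : 'I_2 -> 'rV[R]_4) v : O y ->
  (forall a b, ip (G y) (e a) (e b) = (a == b)%:R) ->
  (forall a, ip (G y) v (e a) = 0) ->
  (forall a, hat (e a) y 2 = 0 /\ hat (e a) y 3 = 0) ->
  (forall a b, dhat (e a) (e b) y 2 = 0 /\ dhat (e a) (e b) y 3 = 0) ->
  - calR_form G y e v - ip (G y) (calA G y e v) v =
  (phi y * H 1 1 y - 2 * p 1 y ^+ 2) / (2 * phi y ^+ 3) * ip (G y) v v.
Proof.
move=> Oy orth vn he dhe.
have f0 := phi_neq0 Oy.
have ve a : (phi y)^-1 * (hat v y 0 * hat (e a) y 0) +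
    phi y * (hat v y 1 * hat (e a) y 1) = 0.
  by rewrite -(vn a) metricE// /ipf /dot3 !(he a).1 !(he a).2 !mulr0 !addr0.
have orth' a b : ipf (phi y)^-1 (phi y) (hat (e a) y) (hat (e b) y) = (a == b)%:R.
  by rewrite -metricE// orth.
have [S T ST] : [/\ hat (e 0) y 0 ^+ 2 + hat (e 1) y 0 ^+ 2 = phi y,
    hat (e 0) y 1 ^+ 2 + hat (e 1) y 1 ^+ 2 = (phi y)^-1 &
    hat (e 0) y 0 * hat (e 0) y 1 + hat (e 1) y 0 * hat (e 1) y 1 = 0].
  have K := @gram_rows _ (phi y) (fun k => hat (e k) y 0) (fun k => hat (e k) y 1).
  move: K => /=; apply; first exact: phi_gt0.
  move=> a b; rewrite -orth' /ipf /dot3 !(he a).1 !(he a).2.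
  by rewrite !mul0r !addr0.
(* The two orthogonality relations form a linear system for components 0 and 1 of [v]. Combined with
   weights taken from the frame, they isolate [hat v y 0] by [S] and [ST], and [hat v y 1] by [T]
   and [ST]. *)
have v0 : hat v y 0 = 0.
  transitivity (hat (e 0) y 0 * ((phi y)^-1 * (hat v y 0 * hat (e 0) y 0) +
      phi y * (hat v y 1 * hat (e 0) y 1))
    + hat (e 1) y 0 * ((phi y)^-1 * (hat v y 0 * hat (e 1) y 0) +
      phi y * (hat v y 1 * hat (e 1) y 1))); last by rewrite !ve !mulr0 addr0.
  transitivity ((phi y)^-1 * hat v y 0 * phi y + phi y * hat v y 1 * 0).
    by field.
  by rewrite -ST -{2}S; ring.
have v1 : hat v y 1 = 0.
  transitivity (hat (e 0) y 1 * ((phi y)^-1 * (hat v y 0 * hat (e 0) y 0) +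
      phi y * (hat v y 1 * hat (e 0) y 1))
    + hat (e 1) y 1 * ((phi y)^-1 * (hat v y 0 * hat (e 1) y 0) +
      phi y * (hat v y 1 * hat (e 1) y 1))); last by rewrite !ve !mulr0 addr0.
  transitivity ((phi y)^-1 * hat v y 0 * 0 + phi y * hat v y 1 * (phi y)^-1).
    by field.
  by rewrite -ST -{2}T; ring.
have secE a : ip (G y) (curvature G (e a) v v y) (e a) =
    ipf (phi y)^-1 (phi y) (curv_frame (phi y)^-1 (dframe y) (p^~ y) (pframe y)
       (hat (e a) y) (hat v y) (hat v y)) (hat (e a) y).
  rewrite metricE//; congr ipf; apply/funext => j; exact: curvature_hat.
have sffE a b : ip (G y) (second_ff G y e (e a) (e b)) v =
    ipf (phi y)^-1 (phi y) (gam (phi y)^-1 (p^~ y) (hat (e a) y) (hat (e b) y))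
      (hat v y).
  rewrite /second_ff /normal_part ipBl ip_suml big1 ?subr0; last first.
    by move=> k _; rewrite ipZl (ipC (e k) v (symG Oy)) vn mulr0.
  rewrite cov_cst metricE// /ipf /dot3 !chr_hat// v0 v1 (dhe a b).1 (dhe a b).2.
  by rewrite !mulr0 !add0r.
have AE : ip (G y) (calA G y e v) v =
    \sum_(a < 2) \sum_(b < 2) ipf (phi y)^-1 (phi y)
      (gam (phi y)^-1 (p^~ y) (hat (e a) y) (hat (e b) y)) (hat v y) ^+ 2.
  rewrite /calA ip_suml; apply: eq_bigr => a _; rewrite ip_suml.
  by apply: eq_bigr => b _; rewrite ipZl sffE expr2.
rewrite AE /calR_form; under eq_bigr => a _ do rewrite secE.
rewrite (metricE v v Oy).
apply: (@frame_stability _ (phi y) (p^~ y) (fun i j => H i j y)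
  (fun a => hat (e a) y) (hat v y)) => //.
- exact: phi_gt0.
- by move=> i j; exact: symH.
- exact: traceH.
- by move=> a; have [] := he a.
- by move=> a; have [] := he a.
Qed.

End LocalFrame.

(** * The potential *)

Section EuclideanSpace.
Context {R : realType}.

Section Dot.
Variable n : nat.
Implicit Types u v w : 'rV[R]_n.

Lemma dotC u v : dot u v = dot v u.
Proof. by rewrite !dotE; apply: eq_bigr => i _; rewrite mulrC. Qed.

Lemma dotDl u v w : dot (u + v) w = dot u w + dot v w.
Proof. by rewrite !dotE -big_split; apply: eq_bigr => i _; rewrite mxE mulrDl. Qed.

Lemma dotZl (a : R) u w : dot (a *: u) w = a * dot u w.
Proof. by rewrite !dotE mulr_sumr; apply: eq_bigr => i _; rewrite mxE mulrA. Qed.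

Lemma dotDr u v w : dot w (u + v) = dot w u + dot w v.
Proof. by rewrite dotC dotDl !(dotC w). Qed.

Lemma dotZr (a : R) u w : dot w (a *: u) = a * dot w u.
Proof. by rewrite dotC dotZl (dotC w). Qed.

Lemma dot_ge0 u : 0 <= dot u u.
Proof. by rewrite dotE; apply: sumr_ge0 => i _; rewrite -expr2 sqr_ge0. Qed.

Lemma dot_eq0 u : (dot u u == 0) = (u == 0).
Proof.
rewrite dotE psumr_eq0 => [|i _]; last by rewrite -expr2 sqr_ge0.
apply/allP/eqP => [H|-> i _]; last by rewrite mxE mulr0 eqxx implybT.
apply/rowP => i; rewrite mxE; apply/eqP.
by have := H i (mem_index_enum i); rewrite /= mulf_eq0 orbb.
Qed.

Lemma euclid_ge0 u : 0 <= euclid u.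
Proof. exact: sqrtr_ge0. Qed.

Lemma euclid_sqr u : euclid u ^+ 2 = dot u u.
Proof. by rewrite /euclid sqr_sqrtr// dot_ge0. Qed.

Lemma euclid_eq0 u : (euclid u == 0) = (u == 0).
Proof. by rewrite -dot_eq0 -euclid_sqr expf_eq0. Qed.

Lemma euclid_gt0 u : (0 < euclid u) = (u != 0).
Proof. by rewrite lt_def euclid_eq0 euclid_ge0 andbT. Qed.

Lemma euclidN u : euclid (- u) = euclid u.
Proof. by rewrite /euclid -scaleN1r dotZl dotZr mulN1r mulN1r opprK. Qed.

Lemma euclidZ (a : R) u : euclid (a *: u) = `|a| * euclid u.
Proof.
by rewrite /euclid dotZl dotZr mulrA -expr2 sqrtrM ?sqr_ge0// sqrtr_sqr.
Qed.

End Dot.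

Implicit Types u v w z : 'rV[R]_3.

Lemma sum_I3 (V : nmodType) (F : 'I_3 -> V) : \sum_(i < 3) F i = F 0 + F 1 + F 2.
Proof.
rewrite 3!big_ord_recl big_ord0 addr0 addrA.
by congr (F _ + F _ + F _); exact: val_inj.
Qed.

Lemma I3_ind (P : 'I_3 -> Prop) : P 0 -> P 1 -> P 2 -> forall j, P j.
Proof.
move=> P0 P1 P2; case=> -[|[|[|//]]] j3.
- by rewrite (_ : Ordinal j3 = 0)//; exact: val_inj.
- by rewrite (_ : Ordinal j3 = 1)//; exact: val_inj.
- by rewrite (_ : Ordinal j3 = 2)//; exact: val_inj.
Qed.

Lemma dot_I3 u v : dot u v = u 0 0 * v 0 0 + u 0 1 * v 0 1 + u 0 2 * v 0 2.
Proof. by rewrite dotE sum_I3. Qed.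

Lemma crossE u v : [/\ cross u v 0 0 = u 0 1 * v 0 2 - u 0 2 * v 0 1,
  cross u v 0 1 = u 0 2 * v 0 0 - u 0 0 * v 0 2 &
  cross u v 0 2 = u 0 0 * v 0 1 - u 0 1 * v 0 0].
Proof.
by split; rewrite mxE; congr (_ * _ - _ * _); congr (_ 0 _); exact: val_inj.
Qed.

(** Turn the first two coordinates by a quarter turn and normalize; if both vanish, the first basis
    vector is already orthogonal to [u]. *)
Lemma orthogonal_unit u : exists2 v, dot v v = 1 & dot u v = 0.
Proof.
have [uv|uv] := eqVneq (u 0 0 ^+ 2 + u 0 1 ^+ 2) 0.
  have u0 : u 0 0 = 0.
    apply/eqP; rewrite -sqrf_eq0 eq_le sqr_ge0 andbT -uv.
    by rewrite lerDl sqr_ge0.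
  exists (\row_(j < 3) (j == 0)%:R); first by rewrite dot_I3 !mxE /=; ring.
  by rewrite dot_I3 !mxE /= u0; ring.
pose d := Num.sqrt (u 0 0 ^+ 2 + u 0 1 ^+ 2).
have d2 : d ^+ 2 = u 0 0 ^+ 2 + u 0 1 ^+ 2.
  by rewrite sqr_sqrtr// addr_ge0 ?sqr_ge0.
have d0 : d != 0 by rewrite -sqrf_eq0 d2.
exists (\row_(j < 3) (if j == 0 then - u 0 1 / d else if j == 1 then u 0 0 / d else 0)).
  rewrite dot_I3 !mxE /=; transitivity ((u 0 0 ^+ 2 + u 0 1 ^+ 2) / d ^+ 2).
    by field.
  by rewrite -d2 divff ?sqrf_eq0.
by rewrite dot_I3 !mxE /=; ring.
Qed.

(* The zero vector in position 0 makes a gradient with respect to this family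
   vanish in the fibre direction. *)
Record oriented_frame (E : 'I_4 -> 'rV[R]_3) : Prop := OrientedFrame {
  frame0 : E 0 = 0;
  frame_unit : forall j, val j != 0%N -> dot (E j) (E j) = 1;
  frame12 : dot (E 1) (E 2) = 0;
  frame13 : dot (E 1) (E 3) = 0;
  frame_dot : forall u v, dot u v = dot3 (fun j => dot u (E j)) (fun j => dot v (E j));
  frame_cross : forall u v w, dot (cross u v) w =
    det3 (fun j => dot u (E j)) (fun j => dot v (E j)) (fun j => dot w (E j))
}.

Lemma oriented_frame_exists d : d != 0 ->
  exists2 E, oriented_frame E & E 1 = (euclid d)^-1 *: d.
Proof.
move=> d0; have [e1 e1E] : exists e1, e1 = (euclid d)^-1 *: d by eexists.
have d1 : euclid d != 0 by rewrite euclid_eq0.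
have e11 : dot e1 e1 = 1.
  by rewrite e1E dotZl dotZr mulrA -euclid_sqr -invfM -expr2 mulVf// sqrf_eq0.
have [e2 e22 e12] := orthogonal_unit e1.
have [e3 e3E] : exists e3, e3 = cross e1 e2 by eexists.
have [c0 c1 c2] := crossE e1 e2; rewrite -e3E in c0 c1 c2.
have e13 : dot e1 e3 = 0 by rewrite dot_I3 c0 c1 c2; ring.
have e23 : dot e2 e3 = 0 by rewrite dot_I3 c0 c1 c2; ring.
have e33 : dot e3 e3 = 1.
  (* Lagrange's identity for the length of a cross product. *)
  transitivity (dot e1 e1 * dot e2 e2 - dot e1 e2 ^+ 2).
    by rewrite !dot_I3 c0 c1 c2; ring.
  by rewrite e11 e22 e12; ring.
pose E (j : 'I_4) := match val j with 1%N => e1 | 2%N => e2 | 3%N => e3 | _ => 0 end.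
exists E => //; split=> //.
- by elim/I4_ind.
- move=> u v; pose M : 'M[R]_3 := \matrix_(i, j)
    (if i == 0 then e1 0 j else if i == 1 then e2 0 j else e3 0 j).
  have MM : M *m M^T = 1%:M.
    have Me i j : (M *m M^T) i j = \sum_(k < 3) M i k * M j k.
      by rewrite mxE; apply: eq_bigr => k _; rewrite [M^T _ _]mxE.
    apply/matrixP => i j; rewrite Me sum_I3 !mxE.
    by elim/I3_ind : i; elim/I3_ind : j => /=; rewrite -dot_I3
      ?e11 ?e12 ?e13 ?e22 ?e23 ?e33// dotC ?e12 ?e13 ?e23.
  (* Orthonormal rows give orthonormal columns, which is Parseval's identity for [dot]. *)
  have MTM := mulmx1C MM.
  have -> : dot u v = ((u *m M^T) *m (v *m M^T)^T) 0 0.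
    by rewrite trmx_mul trmxK mulmxA -(mulmxA u) MTM mulmx1.
  rewrite mxE sum_I3 /dot3.
  have uM w i : (w *m M^T) 0 i = dot w (row i M).
    by rewrite dotE mxE; apply: eq_bigr => k _; rewrite !mxE.
  rewrite ![(v *m M^T)^T _ _]mxE !uM.
  have -> : row 0 M = e1 by apply/rowP => k; rewrite !mxE.
  have -> : row 1 M = e2 by apply/rowP => k; rewrite !mxE.
  by have -> : row 2 M = e3 by apply/rowP => k; rewrite !mxE.
- move=> u v w.
  have [a0 a1 a2] := crossE u v.
  (* [dot e3 e3] is the determinant of the frame, so this factor turns the claim into the
     multiplicativity of determinants, a polynomial identity. *)
  transitivity (dot (cross u v) w * dot e3 e3); first by rewrite e33 mulr1.
  by rewrite /det3 /= !dot_I3 a0 a1 a2 c0 c1 c2; ring.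
Qed.

End EuclideanSpace.

Section Composition.
Context {R : realType} {V : normedModType R}.
Implicit Types (y u : V) (g : V -> R).

Lemma derive_along g y u :
  'D_1 (fun t : R => g (t *: u + y)) (0 : R) = 'D_u g y.
Proof.
rewrite /derive; set g1 := fun h => h^-1 *: _; set g2 := fun h => h^-1 *: _.
suff -> : g1 = g2 by [].
by rewrite funeqE /g1 /g2 => h /=; rewrite addr0 scale0r add0r [_%:A]mulr1.
Qed.

Lemma is_derive_comp (F : R -> R) g y u (dF dg : R) :
  is_derive (g y) 1 F dF -> is_derive y u g dg ->
  is_derive y u (fun z => F (g z)) (dF * dg).
Proof.
move=> HF [/derivable1P Hg <-].
have D : is_derive (0 : R) 1 (fun t : R => g (t *: u + y)) ('D_u g y).
  by split=> //; exact: derive_along.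
have HF' : is_derive (g (0 *: u + y)) 1 F dF by rewrite scale0r add0r.
have [C1 C2] := is_derive1_comp HF' D.
by split; [exact/derivable1P|rewrite -derive_along].
Qed.

End Composition.

Section Potential.
Context {R : realType} {k : nat}.
Variables (p : 'I_k -> 'rV[R]_3) (m : R).

Definition grad_potential (v x : 'rV[R]_3) : R :=
  - \sum_(i < k) dot (x - p i) v / (2 * euclid (x - p i) ^+ 3).

Definition hess_potential (u v x : 'rV[R]_3) : R :=
  \sum_(i < k) (3 * (dot (x - p i) u * dot (x - p i) v) / (2 * euclid (x - p i) ^+ 5)
     - dot u v / (2 * euclid (x - p i) ^+ 3)).

Section Derivatives.
Variables (V : normedModType R) (f : V -> 'rV[R]_3) (y u : V) (w : 'rV[R]_3).
Hypothesis Hf : forall j, is_derive y u (fun z => f z 0 j) (w 0 j).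

Lemma is_derive_dot (q v : 'rV[R]_3) :
  is_derive y u (fun z => dot (f z - q) v) (dot w v).
Proof.
have -> : (fun z => dot (f z - q) v) =
    (fun z => \sum_(j < 3) (f z 0 j - q 0 j) * v 0 j).
  by apply/funext => z; rewrite dotE; apply: eq_bigr => j _; rewrite !mxE.
rewrite dotE; apply: is_derive_sumr => j _.
by have Hj := Hf j; apply: is_derive_eq; rewrite /GRing.scale /=; ring.
Qed.

Lemma is_derive_euclid (q : 'rV[R]_3) : f y != q ->
  is_derive y u (fun z => euclid (f z - q)) (dot (f y - q) w / euclid (f y - q)).
Proof.
move=> fq.
have D : is_derive y u (fun z => dot (f z - q) (f z - q)) (2 * dot (f y - q) w).
  have -> : (fun z => dot (f z - q) (f z - q)) =
      (fun z => \sum_(j < 3) (f z 0 j - q 0 j) * (f z 0 j - q 0 j)).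
    by apply/funext => z; rewrite dotE; apply: eq_bigr => j _; rewrite !mxE.
  rewrite dotE mulr_sumr; apply: is_derive_sumr => j _.
  by have Hj := Hf j; apply: is_derive_eq; rewrite /GRing.scale /= !mxE; ring.
have pos : 0 < dot (f y - q) (f y - q).
  by rewrite lt_def dot_eq0 subr_eq0 fq dot_ge0.
have r0 : euclid (f y - q) != 0 by rewrite euclid_eq0 subr_eq0.
have K := @is_derive_comp _ _ Num.sqrt (fun z => dot (f z - q) (f z - q)) y u _ _
  (is_derive1_sqrt pos) D.
by apply: (is_derive_eq K); rewrite -/(euclid _); field.
Qed.

Hypothesis fU : gh_base p (f y).

Lemma gh_base_neq i : f y != p i.
Proof. by apply/eqP => E; apply: fU; exists i. Qed.

(** Stated along a map [f], it serves both [derive_potential], with the identity, and the projection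
    read in a chart. *)
Lemma is_derive_potential :
  is_derive y u (fun z => gh_potential p m (f z)) (grad_potential w (f y)).
Proof.
suff K : is_derive y u (fun z => \sum_(i < k) (2 * euclid (f z - p i))^-1)
    (grad_potential w (f y)).
  by apply: (is_derive_eq (is_derive_add (is_derive_cst m y u) K)); rewrite add0r.
rewrite /grad_potential -sumrN; apply: is_derive_sumr => i _.
have r0 : euclid (f y - p i) != 0 by rewrite euclid_eq0 subr_eq0 gh_base_neq.
have D := is_derive_euclid (gh_base_neq i).
have D2 := is_derive_scale 2 D.
have n0 : 2 * euclid (f y - p i) != 0 by rewrite mulf_neq0.
by apply: (is_derive_eq (is_derive_inv D2 n0)); field.
Qed.

Lemma is_derive_grad v :
  is_derive y u (fun z => grad_potential v (f z)) (hess_potential w v (f y)).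
Proof.
rewrite /grad_potential /hess_potential -[X in is_derive _ _ _ X]opprK -sumrN.
apply: is_derive_opp; apply: is_derive_sumr => i _.
have r0 : euclid (f y - p i) != 0 by rewrite euclid_eq0 subr_eq0 gh_base_neq.
have D := is_derive_euclid (gh_base_neq i).
have D3 : is_derive y u (fun z => 2 * euclid (f z - p i) ^+ 3)
    (2 * (3 * euclid (f y - p i) ^+ 2 * (dot (f y - p i) w / euclid (f y - p i)))).
  by apply: is_derive_eq; rewrite /GRing.scale /=; ring.
have n0 : 2 * euclid (f y - p i) ^+ 3 != 0 by rewrite mulf_neq0 ?expf_neq0.
have K := is_derive_mul (is_derive_dot (p i) v) (is_derive_inv D3 n0).
by apply: (is_derive_eq K); field.
Qed.

End Derivatives.

Lemma derive_potential x v : gh_base p x ->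
  'D_v (gh_potential p m) x = grad_potential v x.
Proof.
move=> xU; apply: derive_val; apply: (@is_derive_potential _ id) => // j.
have dv : derivable (id : 'rV[R]_3 -> 'rV[R]_3) x v by [].
split; first by move/derivable_mxP : dv; exact.
by have /matrixP/(_ 0 j) := derive_mx dv; rewrite derive_id mxE.
Qed.

Section Frame.
Variables (E : 'I_4 -> 'rV[R]_3) (HE : oriented_frame E) (x : 'rV[R]_3).

Lemma grad_frame w : grad_potential w x =
  dot3 (fun j => dot w (E j)) (fun j => grad_potential (E j) x).
Proof.
rewrite /grad_potential /dot3 !mulrN -!opprD !mulr_sumr -!big_split /=.
congr (- _); apply: eq_bigr => i _.
by rewrite (frame_dot HE (x - p i) w) /dot3; ring.
Qed.

Lemma grad_cross u v : grad_potential (cross u v) x =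
  det3 (fun j => dot u (E j)) (fun j => dot v (E j))
       (fun j => grad_potential (E j) x).
Proof.
rewrite /grad_potential /det3 !mulrN -!opprD !mulr_sumr -!big_split /=.
congr (- _); apply: eq_bigr => i _.
by rewrite dotC (frame_cross HE) /det3; ring.
Qed.

Lemma hess_frame w v : hess_potential w v x =
  dot3 (fun j => dot w (E j)) (fun j => hess_potential (E j) v x).
Proof.
rewrite /hess_potential /dot3 !mulr_sumr -!big_split /=; apply: eq_bigr => i _.
rewrite (frame_dot HE (x - p i) w) (frame_dot HE w v) /dot3 !(dotC (E _) v).
by ring.
Qed.

Lemma hess_sym u v : hess_potential u v x = hess_potential v u x.
Proof.
by apply: eq_bigr => i _; rewrite (dotC v u) [dot _ u * dot _ v]mulrC.
Qed.

(** Harmonicity of [1 / r]: by Parseval the squares add up to [r ^+ 2], and [3 r^2 / r^5] cancels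
    the three terms [1 / r^3]. *)
Lemma hess_trace : gh_base p x ->
  hess_potential (E 1) (E 1) x + hess_potential (E 2) (E 2) x +
  hess_potential (E 3) (E 3) x = 0.
Proof.
move=> xU; rewrite /hess_potential -!big_split big1//= => i _.
rewrite !(frame_unit HE)//.
have r0 : euclid (x - p i) != 0.
  by rewrite euclid_eq0 subr_eq0; apply/eqP => xp; apply: xU; exists i.
have := frame_dot HE (x - p i) (x - p i); rewrite -euclid_sqr /dot3.
set r := euclid _ in r0 *; set a := dot _ _; set b := dot _ _; set c := dot _ _.
move=> rE; transitivity (3 * (a * a + b * b + c * c) / (2 * r ^+ 5) - 3 / (2 * r ^+ 3)).
  by ring.
by rewrite -rE; field.
Qed.

End Frame.
End Potential.

(** * Lower bound for the curvature on the segment *)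

Section Threshold.
Context {R : realType}.

Lemma threshold_polyE k (x : R) :
  (threshold_poly R k).[x] = - 4 * x ^+ 3 + 16 * x ^+ 2 + 2 * x + (k%:R - 2).
Proof. by rewrite /threshold_poly !hornerE. Qed.

(** The threshold polynomial tends to minus infinity, so a nonnegative point where it is positive
    lies strictly before its largest root. It is positive at 4, and it would be positive at [s] if
    [4 s^3 <= k - 2]. *)
Lemma threshold_bound k (Rk s : R) : (2 <= k)%N ->
  largest_root (threshold_poly R k) Rk -> Rk <= s ->
  4 <= s /\ k%:R - 2 < 4 * s ^+ 3.
Proof.
move=> hk [_ Rmax] Rs.
have n0 : 0 <= k%:R - 2 :> R by rewrite subr_ge0 ler_nat.
pose P := - threshold_poly R k.
have PE x : P.[x] = 4 * x ^+ 3 - 16 * x ^+ 2 - 2 * x - (k%:R - 2).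
  by rewrite /P hornerN threshold_polyE; ring.
have beyond x : 0 <= x -> P.[x] < 0 -> x < Rk.
  (* From [b >= 5] and [b >= k - 2] follows [4 b^3 - 16 b^2 >= 4 b^2 >= 3 b], which absorbs the
     lower terms; the summand [x] places [b] to the right of [x]. *)
  move=> x0 Px; pose b := x + 5 + (k%:R - 2).
  have Pb : 0 <= P.[b].
    have b5 : 5 <= b by rewrite /b; lra.
    have bk : k%:R - 2 <= b by rewrite /b; lra.
    rewrite PE; have : 0 <= (b - 5) * b ^+ 2 by rewrite mulr_ge0 ?sqr_ge0 ?subr_ge0.
    by rewrite exprS; nra.
  have xb : x <= b by rewrite /b; lra.
  have Pxb : P.[x] <= 0 <= P.[b] by rewrite (ltW Px).
  have [z /andP[xz _] /rootP rz] := poly_ivt xb Pxb.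
  have zR : z <= Rk.
    by apply: Rmax; apply/rootP; apply/eqP; rewrite -oppr_eq0 -hornerN -/P rz.
  rewrite lt_neqAle (le_trans xz zR) andbT; apply/eqP => xR.
  have zx : z = x by apply/eqP; rewrite eq_le xz xR zR.
  by move: Px; rewrite -zx rz ltxx.
have s4 : 4 <= s.
  apply: le_trans Rs; apply/ltW/beyond => //.
  by rewrite PE; lra.
split => //; rewrite ltNge; apply/negP => H.
have Ps : P.[s] < 0 by rewrite PE; have := sqr_ge0 s; nra.
by have := beyond s (le_trans _ s4) Ps; rewrite ltNge Rs => /(_ (ler0n _ 4)).
Qed.

End Threshold.

Section Bound.
Context {R : realType}.

(** Evaluate the quadratic at its minimum [S / P]; for [P = 0] it is affine in [l], and
    nonnegativity forces [S = 0]. *)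
Lemma discriminant_le (P Q S : R) : 0 <= P ->
  (forall l, 0 <= l ^+ 2 * P - 2 * l * S + Q) -> S ^+ 2 <= P * Q.
Proof.
move=> P0 H; have [Pz|Pz] := eqVneq P 0.
  have [->|S0] := eqVneq S 0; first by rewrite Pz mul0r expr0n.
  have := H ((Q + 1) / (2 * S)); rewrite Pz mulr0 add0r.
  have -> : - (2 * ((Q + 1) / (2 * S)) * S) + Q = -1 by field.
  by rewrite oppr_ge0 ler10.
have := H (S / P).
have -> : (S / P) ^+ 2 * P - 2 * (S / P) * S + Q = (P * Q - S ^+ 2) / P by field.
by rewrite pmulr_lge0 ?invr_gt0 ?lt_def ?Pz// subr_ge0.
Qed.

(* The potential along the segment is [a / (a^2 - X^2) + P], [S] and [3 Q - T]
   being the derivatives of [P]. *)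
Lemma segment_curvature_algebra (a X P Q S T : R) : `|X| < a -> 0 <= P ->
  (forall l, 0 <= l ^+ 2 * P - 2 * l * S + Q) ->
  let u := a ^+ 2 - X ^+ 2 in
  let A := a / u + P in
  let B := 2 * a * X / u ^+ 2 + S in
  let C := (2 * a ^+ 3 + 6 * a * X ^+ 2) / u ^+ 3 + (3 * Q - T) in
  u ^+ 2 * T <= 2 * a ->
  (2 * a - u ^+ 2 * T) / (2 * (a + u * P) ^+ 2) <= (A * C - 2 * B ^+ 2) / (2 * A ^+ 3).
Proof.
move=> Xa P0 H u A B C uT.
have a0 : 0 < a by apply: le_lt_trans Xa.
have u0 : 0 < u.
  by rewrite subr_gt0 -(real_normK (num_real X)) ltr_pXn2r// nnegrE ltW.
have un0 : u != 0 by rewrite gt_eqF.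
have D0 : 0 < a + u * P by rewrite ltr_pwDl// mulr_ge0// ltW.
have Dn0 : a + u * P != 0 by rewrite gt_eqF.
have SPQ := discriminant_le P0 H.
have Q0 : 0 <= Q by have := H 0; rewrite expr0n mul0r mulr0 mul0r subr0 add0r.
(* The quadratic form at [l = 2 X / u], times [u ^+ 2]: this is the combination formed by the cross
   terms of [A * C] and [2 * B ^+ 2]. *)
have HX : 0 <= 4 * X ^+ 2 * P - 4 * X * u * S + u ^+ 2 * Q.
  have := mulr_ge0 (sqr_ge0 u) (H (2 * X / u)); congr (_ <= _); by field.
have AE : A = (a + u * P) / u by rewrite /A; field.
have CE : C = (2 * a * u + 8 * a * X ^+ 2) / u ^+ 3 + (3 * Q - T).
  by rewrite /C; congr (_ / _ + _); rewrite /u; ring.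
(* The factor 3 of [Q] is split as 2 + 1: two copies complete the form in [HX] and absorb [2 S^2],
   and the third leaves nonnegative terms. *)
have -> : (A * C - 2 * B ^+ 2) / (2 * A ^+ 3) =
  ((a + u * P) * (2 * a - u ^+ 2 * T)
   + 2 * a * (4 * X ^+ 2 * P - 4 * X * u * S + u ^+ 2 * Q)
   + a * u ^+ 2 * Q + u ^+ 3 * (P * Q)
   + 2 * u ^+ 3 * (P * Q - S ^+ 2)) / (2 * (a + u * P) ^+ 3).
  by rewrite AE CE /B; clearbody u; field; rewrite Dn0.
have -> : (2 * a - u ^+ 2 * T) / (2 * (a + u * P) ^+ 2) =
   (a + u * P) * (2 * a - u ^+ 2 * T) / (2 * (a + u * P) ^+ 3).
  by clearbody u; field.
rewrite ler_pM2r ?invr_gt0 ?mulr_gt0 ?exprn_gt0//.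
have PQ : 0 <= P * Q by rewrite mulr_ge0.
have u2 := ltW u0.
have E1 : 0 <= a * u ^+ 2 * Q by rewrite !mulr_ge0 ?exprn_ge0// ltW.
have E2 : 0 <= u ^+ 3 * (P * Q) by rewrite mulr_ge0 ?exprn_ge0.
have E3 : 0 <= 2 * u ^+ 3 * (P * Q - S ^+ 2).
  by rewrite mulr_ge0 ?subr_ge0// mulr_ge0 ?exprn_ge0.
have E4 : 0 <= 2 * a * (4 * X ^+ 2 * P - 4 * X * u * S + u ^+ 2 * Q).
  by rewrite mulr_ge0// mulr_ge0// ltW.
lra.
Qed.

End Bound.

Section Segment.
Context {R : realType} (k : nat) (hk : (2 <= k)%N).
Variables (p : 'I_k -> 'rV[R]_3) (m s : R).
Let i1 : 'I_k := Ordinal (ltnW hk).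
Let i2 : 'I_k := Ordinal hk.
Let a := euclid (p i1 - p i2) / 2.
Let q := 2^-1 *: (p i1 + p i2).
Hypotheses (p_inj : injective p) (m0 : 0 <= m) (s0 : 0 < s).
Hypothesis ks : k%:R - 2 < 4 * s ^+ 3.
Hypothesis hfar : forall i : 'I_k, (1 < i)%N -> (s + 1) * a < euclid (q - p i).

Lemma sum_split2 (F : 'I_k -> R) :
  \sum_(i < k) F i = F i1 + F i2 + \sum_(i < k | (1 < i)%N) F i.
Proof.
rewrite (bigD1 i1)//= (bigD1 i2)//= addrA; congr (_ + _); apply: eq_bigl => i.
by rewrite -!val_eqE /=; case: (val i) => [|[|]].
Qed.

Lemma sum_far_le (F : 'I_k -> R) c : (forall i : 'I_k, (1 < i)%N -> F i <= c) ->
  \sum_(i < k | (1 < i)%N) F i <= (k%:R - 2) * c.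
Proof.
(* Applied to a constant, [sum_split2] counts the far indices. *)
move=> Fc; have -> : (k%:R - 2) * c = \sum_(i < k | (1 < i)%N) c.
  have := sum_split2 (fun=> c); rewrite sumr_const card_ord -[_ *+ k]mulr_natl.
  by move=> /esym E; apply: (addrI (c + c)); rewrite E; ring.
exact: ler_sum.
Qed.

Lemma half_length_gt0 : 0 < a.
Proof.
rewrite divr_gt0// euclid_gt0 subr_eq0; apply/eqP => /p_inj/eqP.
by rewrite -val_eqE.
Qed.

Variable E : 'I_4 -> 'rV[R]_3.
Hypothesis HE : oriented_frame E.
Hypothesis E1 : E 1 = (euclid (p i2 - p i1))^-1 *: (p i2 - p i1).

Let dE : p i2 - p i1 = (2 * a) *: E 1.
Proof.
have d0 : euclid (p i2 - p i1) != 0.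
  rewrite euclid_eq0 subr_eq0; apply/eqP => /p_inj/eqP.
  by rewrite -val_eqE.
have -> : 2 * a = euclid (p i2 - p i1) by rewrite /a -opprB euclidN; field.
by rewrite E1 scalerA divff// scale1r.
Qed.

Section Point.
Variable t : R.
Hypothesis t01 : 0 < t < 1.
Let x := (1 - t) *: p i1 + t *: p i2.
Let X := (2 * t - 1) * a.

Let Xa : `|X| < a.
Proof.
have a0 := half_length_gt0; case/andP: t01 => t0 t1.
by rewrite ltr_norml /X; apply/andP; split; nra.
Qed.

Let x1 : x - p i1 = (a + X) *: E 1.
Proof.
have -> : (a + X) *: E 1 = t *: ((2 * a) *: E 1).
  by rewrite scalerA; congr (_ *: _); rewrite /X; ring.
by rewrite -dE; apply/rowP => j; rewrite !mxE; ring.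
Qed.

Let x2 : x - p i2 = (X - a) *: E 1.
Proof.
have -> : (X - a) *: E 1 = (t - 1) *: ((2 * a) *: E 1).
  by rewrite scalerA; congr (_ *: _); rewrite /X; ring.
by rewrite -dE; apply/rowP => j; rewrite !mxE; ring.
Qed.

Let xq : x - q = X *: E 1.
Proof.
have -> : X *: E 1 = (t - 2^-1) *: ((2 * a) *: E 1).
  by rewrite scalerA; congr (_ *: _); rewrite /X; field.
by rewrite -dE; apply/rowP => j; rewrite !mxE; field.
Qed.

Let e11 : dot (E 1) (E 1) = 1 := frame_unit HE (isT : val (1 : 'I_4) != 0%N).

Let eu1 : euclid (E 1) = 1.
Proof. by rewrite /euclid e11 sqrtr1. Qed.

Let r1 : euclid (x - p i1) = a + X.
Proof.
rewrite x1 euclidZ eu1 mulr1 ger0_norm//.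
by have := Xa; rewrite ltr_norml; lra.
Qed.

Let r2 : euclid (x - p i2) = a - X.
Proof.
rewrite x2 euclidZ eu1 mulr1 ler0_norm ?opprB//.
by have := Xa; rewrite ltr_norml; lra.
Qed.

(** Reverse triangle inequality: [x] is less than [a] away from the midpoint [q], which uses up the
    summand 1 in [s + 1]. *)
Lemma far_point i : (1 < val i)%N -> s * a < euclid (x - p i).
Proof.
move=> /hfar; set D := euclid (q - p i) => Ds.
have a0 := half_length_gt0; have sa : 0 < s * a by rewrite mulr_gt0.
have D0 : 0 <= D := euclid_ge0 _; rewrite mulrDl mul1r in Ds.
set r := euclid _; have r0 : 0 <= r := euclid_ge0 _.
(* The component along the segment; Bessel's inequality [c^2 <= D^2] takes the place of
   Cauchy-Schwarz, as [x - q] is a multiple of [E 1]. *)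
pose c := dot (q - p i) (E 1).
have cD : c ^+ 2 <= D ^+ 2.
  rewrite /D euclid_sqr (frame_dot HE) /dot3 -/c -!expr2 -addrA lerDl.
  by rewrite addr_ge0 ?sqr_ge0.
have rE : r ^+ 2 = X ^+ 2 + 2 * X * c + D ^+ 2.
  rewrite /r -(subrKA q) xq !euclid_sqr /c; move: (q - p i) => w.
  by rewrite dotDl !dotDr !dotZl !dotZr e11 (dotC (E 1) w); ring.
have Xc : - (`|X| * D) <= X * c.
  rewrite lerNl (le_trans (ler_norm _))// normrN normrM ler_wpM2l//.
  by rewrite -(ger0_norm D0) -ler_sqr ?nnegrE// !real_normK ?num_real.
have rD : (D - `|X|) ^+ 2 <= r ^+ 2.
  by rewrite rE -(real_normK (num_real X)); nra.
rewrite ler_sqr ?nnegrE// in rD; last by have := Xa; lra.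
by apply: lt_le_trans rD; have := Xa; lra.
Qed.

Lemma segment_gh_base : gh_base p x.
Proof.
move=> [i _ pix]; have : 0 < euclid (x - p i); last first.
  by rewrite pix subrr euclid_gt0 eqxx.
have [i0|i0] := ltnP 1 i.
  by apply: lt_trans (far_point i0); rewrite mulr_gt0 ?half_length_gt0.
have := Xa; rewrite ltr_norml => Xa'.
move: i0; rewrite leq_eqVlt => /orP[/eqP iE|]; last rewrite ltnS leqn0 => /eqP iE.
  by rewrite (_ : i = i2) ?r2; [lra|exact: val_inj].
by rewrite (_ : i = i1) ?r1; [lra|exact: val_inj].
Qed.

(** The bound of [segment_curvature_algebra] in the worst case: [u <= a^2], and each of the [k - 2]
    far distances in [P] and [T] replaced by [s * a]. It does not depend on [t]. *)
Definition curvature_lower_bound : R :=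
  (2 * a - a * (k%:R - 2) / (2 * s ^+ 3)) /
  (2 * (a + a ^+ 2 * (m + (k%:R - 2) / (2 * s * a))) ^+ 2).

(** The numerator is [a / (2 s^3)] times [4 s^3 - (k - 2)], so its sign is given by [ks]. *)
Lemma curvature_lower_bound_gt0 : 0 < curvature_lower_bound.
Proof.
have a0 := half_length_gt0.
have n0 : 0 <= k%:R - 2 :> R by rewrite subr_ge0 ler_nat.
apply: divr_gt0.
  have -> : 2 * a - a * (k%:R - 2) / (2 * s ^+ 3) =
      a / (2 * s ^+ 3) * (4 * s ^+ 3 - (k%:R - 2)).
    by field; rewrite gt_eqF.
  by rewrite mulr_gt0 ?subr_gt0// divr_gt0// mulr_gt0// exprn_gt0.
rewrite mulr_gt0// exprn_gt0// ltr_pwDl// mulr_ge0 ?sqr_ge0// addr_ge0//.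
by rewrite divr_ge0// mulr_ge0 ?ltW// mulr_gt0.
Qed.

Lemma segment_curvature_bound :
  let phi := gh_potential p m x in
  0 < phi /\ curvature_lower_bound <=
  (phi * hess_potential p (E 1) (E 1) x - 2 * grad_potential p (E 1) x ^+ 2) /
  (2 * phi ^+ 3).
Proof.
have a0 := half_length_gt0; have Xa' := Xa.
have l0 : 0 < euclid (p i1 - p i2) by move: a0; rewrite /a pmulr_lgt0// invr_gt0.
have n0 : 0 <= k%:R - 2 :> R by rewrite subr_ge0 ler_nat.
pose r i := euclid (x - p i); pose b i := dot (x - p i) (E 1).
have r0 i : (1 < val i)%N -> 0 < r i.
  by move=> i0; apply: lt_trans (far_point i0); rewrite mulr_gt0.
pose P := m + \sum_(i < k | (1 < i)%N) (2 * r i)^-1.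
pose S := - \sum_(i < k | (1 < i)%N) b i / (2 * r i ^+ 3).
pose Q := \sum_(i < k | (1 < i)%N) b i ^+ 2 / (2 * r i ^+ 5).
pose T := \sum_(i < k | (1 < i)%N) (2 * r i ^+ 3)^-1.
pose u := a ^+ 2 - X ^+ 2.
have P0 : 0 <= P.
  rewrite addr_ge0// sumr_ge0// => i /r0/ltW ri.
  by rewrite invr_ge0 mulr_ge0.
have H l : 0 <= l ^+ 2 * P - 2 * l * S + Q.
  (* A sum of squares with weights [1 / (2 r)], one for each far point: [b / r^2] is the ratio by
     which [1 / r] turns into its derivative, up to sign. *)
  have -> : l ^+ 2 * P - 2 * l * S + Q = l ^+ 2 * m +
      \sum_(i < k | (1 < i)%N) (l + b i / r i ^+ 2) ^+ 2 / (2 * r i).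
    rewrite /P /S mulrDr -addrA -addrA; congr (_ + _).
    rewrite mulrN opprK !mulr_sumr -!big_split /=; apply: eq_bigr => i /r0 ri.
    by field; rewrite gt_eqF.
  apply: addr_ge0; first by rewrite mulr_ge0// sqr_ge0.
  apply: sumr_ge0 => i /r0/ltW ri.
  by rewrite divr_ge0 ?sqr_ge0// mulr_ge0.
have Xa2 : `|X| ^+ 2 = X ^+ 2 by rewrite real_normK ?num_real.
have u0 : 0 < u by rewrite /u -Xa2; have := normr_ge0 X; nra.
have ua : u <= a ^+ 2 by rewrite /u lerBlDr lerDl sqr_ge0.
have sa : 0 < s * a by rewrite mulr_gt0.
have Tle : T <= (k%:R - 2) * (2 * (s * a) ^+ 3)^-1.
  apply: sum_far_le => i i0; rewrite lef_pV2 ?posrE ?mulr_gt0 ?exprn_gt0 ?r0//.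
  by rewrite ler_pM2l// lerXn2r ?nnegrE ?ltW ?r0// far_point.
have Ple : P <= m + (k%:R - 2) * (2 * (s * a))^-1.
  rewrite /P lerD2l; apply: sum_far_le => i i0.
  rewrite lef_pV2 ?posrE ?mulr_gt0 ?r0//.
  by rewrite ler_pM2l// ltW// far_point.
have T0 : 0 <= T.
  by rewrite /T; apply: sumr_ge0 => i /r0 ri; rewrite invr_ge0 mulr_ge0 ?exprn_ge0 ?ltW.
have u4 : u ^+ 2 <= a ^+ 4.
  by rewrite (_ : a ^+ 4 = (a ^+ 2) ^+ 2) ?lerXn2r ?nnegrE ?sqr_ge0// ?ltW// -exprM.
have sn0 : s != 0 by rewrite gt_eqF.
have an0 : a != 0 by rewrite gt_eqF.
have uT : u ^+ 2 * T <= a * (k%:R - 2) / (2 * s ^+ 3).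
  apply: (@le_trans _ _ (a ^+ 4 * ((k%:R - 2) * (2 * (s * a) ^+ 3)^-1))).
    by rewrite ler_pM ?sqr_ge0.
  rewrite le_eqVlt; apply/orP; left; apply/eqP; field; by rewrite sn0 an0.
have num0 : a * (k%:R - 2) / (2 * s ^+ 3) <= 2 * a.
  rewrite ler_pdivrMr ?mulr_gt0 ?exprn_gt0//; have := ltW ks; nra.
have phiE : gh_potential p m x = a / u + P.
  rewrite /gh_potential sum_split2 r1 r2 /P addrCA; congr (_ + _).
  have := Xa'; rewrite ltr_norml => /andP[Xl Xr].
  have A1 : a + X != 0 by rewrite gt_eqF//; lra.
  have A2 : a - X != 0 by rewrite gt_eqF//; lra.
  have -> : u = (a + X) * (a - X) by rewrite /u; ring.
  by field; rewrite A1 A2.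
have gradE : grad_potential p (E 1) x = 2 * a * X / u ^+ 2 + S.
  rewrite /grad_potential sum_split2 r1 r2 opprD; congr (_ + _).
  have := Xa'; rewrite ltr_norml => /andP[Xl Xr].
  have A1 : a + X != 0 by rewrite gt_eqF//; lra.
  have A2 : a - X != 0 by rewrite gt_eqF//; lra.
  have -> : u = (a + X) * (a - X) by rewrite /u; ring.
  rewrite x1 x2 !dotZl e11; field.
  by rewrite A1 A2.
have hessE : hess_potential p (E 1) (E 1) x =
    (2 * a ^+ 3 + 6 * a * X ^+ 2) / u ^+ 3 + (3 * Q - T).
  rewrite /hess_potential sum_split2 r1 r2 e11; congr (_ + _); last first.
    rewrite /Q /T mulr_sumr -sumrB; apply: eq_bigr => i _.
    by rewrite -/(b i) -/(r i); ring.
  have := Xa'; rewrite ltr_norml => /andP[Xl Xr].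
  have A1 : a + X != 0 by rewrite gt_eqF//; lra.
  have A2 : a - X != 0 by rewrite gt_eqF//; lra.
  have -> : u = (a + X) * (a - X) by rewrite /u; ring.
  rewrite x1 x2 !dotZl e11; field.
  by rewrite A1 A2.
move=> phi; split; first by rewrite /phi phiE ltr_pwDl// divr_gt0.
rewrite /phi phiE gradE hessE.
apply: le_trans (segment_curvature_algebra Xa' P0 H _); last exact: le_trans uT num0.
rewrite -/u /curvature_lower_bound.
have D0 : 0 < a + u * P by rewrite ltr_pwDl// mulr_ge0// ltW.
have DD : a + u * P <= a + a ^+ 2 * (m + (k%:R - 2) / (2 * s * a)).
  rewrite lerD2l ler_pM ?(ltW u0)//; rewrite -mulrA; exact: Ple.
apply: ler_pM.
- by rewrite subr_ge0.
- by rewrite invr_ge0 mulr_ge0// sqr_ge0.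
- by rewrite lerB.
have D1 := lt_le_trans D0 DD.
have Dsq := lerXn2r 2 (ltW D0) (ltW D1) DD.
by rewrite lef_pV2 ?posrE ?(mulr_gt0, exprn_gt0)// ler_pM2l.
Qed.

End Point.
End Segment.

(** * Charts of Gibbons-Hawking manifolds *)

Section RowValued.
Context {R : realType} {n d : nat}.
Implicit Types (O : set 'rV[R]_n) (f : 'rV[R]_n -> 'rV[R]_d).

Lemma smooth_map_differentiable O f y : open O -> smooth_map O f -> O y ->
  differentiable f y.
Proof.
move=> oO sf Oy.
have -> : f = \sum_(j < d) (fun z => f z 0 j *: delta_mx 0 j).
  by apply/funext => z; rewrite [f z]row_sum_delta fct_sumE.
apply: differentiable_sum => j; apply: differentiableZl.
by have [] := smooth_diff oO (sf j) Oy.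
Qed.

Lemma smooth_dot O f (v : 'rV[R]_d) : open O -> smooth_map O f ->
  smooth_fun O (fun z => dot (f z) v).
Proof.
move=> oO sf; have S := @smooth_sum _ _ O 'I_d (index_enum 'I_d) xpredT
  (fun j z => v 0 j * f z 0 j) oO.
apply: (smooth_ext oO _ (S _)).
  by move=> z _; rewrite dotE; apply: eq_bigr => j _; rewrite mulrC.
by move=> j _; apply: smoothZ.
Qed.

Lemma derive_dot O f (v : 'rV[R]_d) y u : open O -> smooth_map O f -> O y ->
  'D_u (fun z => dot (f z) v) y = dot ('D_u f y) v.
Proof.
move=> oO sf Oy.
have df : derivable f y u.
  by apply: diff_derivable; exact: smooth_map_differentiable Oy.
have -> : (fun z => dot (f z) v) = (fun z => \sum_(j < d) v 0 j * f z 0 j).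
  by apply/funext => z; rewrite dotE; apply: eq_bigr => j _; rewrite mulrC.
rewrite derive_mx// dotE; apply: derive_val.
have -> : \sum_(j < d) (\matrix_(i, j) 'D_u (fun t => f t i j) y : 'rV_d) 0 j * v 0 j =
    \sum_(j < d) v 0 j * 'D_u (fun t => f t 0 j) y.
  by apply: eq_bigr => j _; rewrite mxE mulrC.
apply: is_derive_sumr => j _; apply: is_derive_scale.
exact: (smooth_is_derive oO (sf j)).
Qed.

Lemma cvg_ray (y u : 'rV[R]_n) : (fun h : R => h *: u + y) @ 0 --> y.
Proof.
rewrite -[X in _ --> X]add0r -(scale0r u).
by apply: cvgD; [apply: cvgZr_tmp; exact: cvg_id|exact: cvg_cst].
Qed.

(** The ray from [y] in a tangent direction stays in the slice, so the difference quotient vanishes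
    near 0. *)
Lemma derive_slice O (g : 'rV[R]_n -> R) C e y u : open O -> O y ->
  tangent_slice e y -> tangent_slice e u ->
  (forall z, O z -> tangent_slice e z -> g z = C) -> 'D_u g y = 0.
Proof.
move=> oO Oy ty tu gC; apply: lim_near_cst => //.
have cy := @cvg_ray y u.
have nO : \forall h \near (0 : R), O (h *: u + y).
  by apply: cy; exact: open_nbhs_nbhs.
apply: cvg_within; near=> h => /=.
rewrite (gC y)// (gC (h *: u + y)) ?subrr ?scaler0//; first by near: h.
by move=> j ej; rewrite !mxE (tu j ej) (ty j ej) mulr0 addr0.
Unshelve. all: by end_near. Qed.

End RowValued.

Section ChartGeometry.
Context {R : realType} {k : nat}.
Variables (p : 'I_k -> 'rV[R]_3) (m : R) (X : gibbons_hawking p m).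
Variables (c : chart R X 4).
Hypothesis ac : atlas c.
Hypotheses (m0 : 0 <= m) (k0 : (0 < k)%N).

Let f : 'rV[R]_4 -> 'rV[R]_3 := @gh_proj R k p m X \o chart_inv c.
Let O1 : set 'rV[R]_4 := chart_img c setT.
Let O : set 'rV[R]_4 := chart_img c (@gh_proj R k p m X @^-1` gh_base p).

Lemma chart_imgE (W : set X) y :
  chart_img c W y <-> chart_img c setT y /\ W (chart_inv c y).
Proof.
split=> [[x [Wx dx] <-]|[[x [_ dx] <-] Wx]].
  by rewrite chart_mapK//; split=> //; exists x.
by exists x => //; split=> //; rewrite chart_mapK in Wx.
Qed.

Lemma chart_img_dom y : chart_img c setT y ->
  chart_dom c (chart_inv c y) /\ chart_map c (chart_inv c y) = y.
Proof. by move=> [x [_ dx] <-]; rewrite chart_mapK. Qed.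

Lemma chart_img_open1 : open O1.
Proof.
rewrite /O1 /chart_img (_ : setT `&` chart_dom c = chart_dom c); last first.
  by rewrite setTI.
exact: chart_img_open.
Qed.

Let sf : smooth_map O1 f.
Proof. by move=> j; exact: gh_proj_smooth. Qed.

Lemma gh_base_open : open (gh_base p).
Proof.
rewrite /gh_base openC.
have acc : accessible_space 'rV[R]_3.
  exact/hausdorff_accessible/norm_hausdorff.
by move/accessible_finite_set_closed : acc; apply; exact: finite_image.
Qed.

Lemma gh_potential_gt0 x : gh_base p x -> 0 < gh_potential p m x.
Proof.
move=> xU; pose i := Ordinal k0.
have ri : 0 < euclid (x - p i).
  by rewrite euclid_gt0 subr_eq0; apply/eqP => xp; apply: xU; exists i.
rewrite /gh_potential (bigD1 i)//= ltr_wpDl// ltr_pwDl ?invr_gt0 ?mulr_gt0//.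
by apply: sumr_ge0 => j _; rewrite invr_ge0 mulr_ge0 ?euclid_ge0.
Qed.

Lemma chart_base_open : open O.
Proof.
rewrite openE => y /chart_imgE[y1 Uy].
have cf : {for y, continuous f}.
  exact/differentiable_continuous/(smooth_map_differentiable chart_img_open1 sf).
rewrite /interior; near=> z; apply/chart_imgE; split.
  by near: z; apply: open_nbhs_nbhs; split=> //; exact: chart_img_open1.
by near: z; apply: cf; apply: open_nbhs_nbhs; split=> //; exact: gh_base_open.
Unshelve. all: by end_near. Qed.

Let OO1 : O `<=` O1.
Proof. by move=> y /chart_imgE[]. Qed.

Let fO y : O y -> gh_base p (f y).
Proof. by move=> /chart_imgE[]. Qed.

Variable E : 'I_4 -> 'rV[R]_3.
Hypothesis HE : oriented_frame E.

(** The exact forms are smooth on the whole chart image [O1], whereas the connection form lives only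
    over [O], away from the fixed points. *)
Definition gh_coframe (j : 'I_4) (y : 'rV[R]_4) : 'rV[R]_4 :=
  if val j == 0%N then @gh_conn R k p m X c y
  else \row_i 'D_(delta_mx 0 i) (fun z => dot (f z) (E j)) y.

Let sfE j : smooth_fun O1 (fun z => dot (f z) (E j)).
Proof. exact: (smooth_dot _ chart_img_open1 sf). Qed.

Lemma hat_coframe u y j : O1 y -> val j != 0%N ->
  hat gh_coframe u y j = dot ('D_u f y) (E j).
Proof.
move=> O1y j0; rewrite /hat /gh_coframe (negbTE j0).
rewrite -(derive_dot _ _ chart_img_open1 sf)//.
rewrite (smooth_deriveE chart_img_open1 (sfE j))// dotE.
by apply: eq_bigr => i _; rewrite mxE mulrC.
Qed.

Lemma hat_coframeD u y j : O1 y -> val j != 0%N ->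
  hat gh_coframe u y j = 'D_u (fun z => dot (f z) (E j)) y.
Proof.
by move=> O1y j0; rewrite hat_coframe// (derive_dot _ _ chart_img_open1 sf).
Qed.

Lemma smooth_coframe j i : smooth_fun O (fun y => gh_coframe j y 0 i).
Proof.
rewrite /gh_coframe; case: eqVneq => j0.
  by have [[H _] _ _] := gh_connection X; exact: H.
apply: (@smooth_ext _ _ O ('D_(delta_mx 0 i) (fun z => dot (f z) (E j)))).
- exact: chart_base_open.
- by move=> y _; rewrite mxE.
apply: (smooth_subset OO1); apply: smooth_partial; exact: sfE.
Qed.

Let df y : O1 y -> differentiable f y.
Proof. exact: (smooth_map_differentiable chart_img_open1 sf). Qed.

Let jacE u y : O1 y -> u *m 'J f y = 'D_u f y.
Proof. by move=> /df d; rewrite deriveEjacobian. Qed.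

Let dot3_hat u y (q : 'I_4 -> R) : O1 y ->
  dot3 (hat gh_coframe u y) q = dot3 (fun j => dot ('D_u f y) (E j)) q.
Proof. by move=> O1y; rewrite /dot3 !hat_coframe. Qed.

Let det3_hat u v y (q : 'I_4 -> R) : O1 y ->
  det3 (hat gh_coframe u y) (hat gh_coframe v y) q =
  det3 (fun j => dot ('D_u f y) (E j)) (fun j => dot ('D_v f y) (E j)) q.
Proof. by move=> O1y; rewrite /det3 !hat_coframe. Qed.

Let fcoord u y j : O1 y -> is_derive y u (fun z => f z 0 j) ('D_u f y 0 j).
Proof.
move=> O1y; rewrite derive_mx ?mxE; last exact/diff_derivable/df.
exact: (smooth_is_derive chart_img_open1 (sf j)).
Qed.

Lemma coframe_potential y u : O y ->
  is_derive y u (fun z => gh_potential p m (f z))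
   (dot3 (hat gh_coframe u y) (fun j => grad_potential p (E j) (f y))).
Proof.
move=> Oy; rewrite dot3_hat -?grad_frame//; last exact: OO1.
by apply: is_derive_potential; [move=> j; exact/fcoord/OO1|exact: fO].
Qed.

Lemma coframe_grad y u j : O y ->
  is_derive y u (fun z => grad_potential p (E j) (f z))
   (dot3 (hat gh_coframe u y) (fun i => hess_potential p (E i) (E j) (f y))).
Proof.
move=> Oy; rewrite dot3_hat -?hess_frame//; last exact: OO1.
by apply: is_derive_grad; [move=> i; exact/fcoord/OO1|exact: fO].
Qed.

Lemma coframe_metric y u v : O y ->
  ip (gh_metric X c y) u v = ipf (gh_potential p m (f y))^-1
    (gh_potential p m (f y)) (hat gh_coframe u y) (hat gh_coframe v y).
Proof.
move=> Oy; rewrite gh_metricE// -/f !jacE; try exact: OO1.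
have hE (j : 'I_4) : val j != 0%N -> forall w,
    hat gh_coframe w y j = dot ('D_w f y) (E j).
  by move=> j0 w; apply: hat_coframe => //; exact: OO1.
rewrite (frame_dot HE) /ipf /dot3 !(hE 1 isT) !(hE 2 isT) !(hE 3 isT).
by rewrite /hat /gh_coframe /= mulrA.
Qed.

(** For index 0 this is [gh_monopole], the Hodge star becoming a determinant by [grad_cross]. The
    other forms are exact, and the claim is the symmetry of second derivatives. *)
Lemma coframe_structure y u v j : O y ->
  'D_u (fun z => hat gh_coframe v z j) y - 'D_v (fun z => hat gh_coframe u z j) y =
  if val j == 0%N then det3 (hat gh_coframe u y) (hat gh_coframe v y)
    (fun i => grad_potential p (E i) (f y)) else 0.
Proof.
move=> Oy; have O1y := OO1 Oy; case: eqVneq => j0.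
  have -> : j = 0 by exact: val_inj.
  have := @gh_monopole _ _ _ _ X c y u v ac Oy.
  rewrite /ext_deriv /hodge_df -/f !jacE// derive_potential ?fO//; last exact: fO.
  by rewrite (grad_cross _ HE) det3_hat.
have D w w' : 'D_w (fun z => hat gh_coframe w' z j) y =
    'D_w ('D_w' (fun z => dot (f z) (E j))) y.
  apply: near_eq_derive; apply: (open_near_eq chart_img_open1 O1y) => z O1z.
  exact: hat_coframeD.
by rewrite !D (schwarz _ _ chart_img_open1 (sfE j) O1y) subrr.
Qed.

Variable N : set X.
Hypothesis slice : slice_chart 2 N c.
Variables (d x0 : 'rV[R]_3).
Hypothesis Nline : forall x, N x -> exists t, gh_proj x = x0 + t *: d.
Hypotheses (d2 : dot d (E 2) = 0) (d3 : dot d (E 3) = 0).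

(** The slice projects into a line of direction [d], so coordinates orthogonal to [d] are constant
    on it; [slice_hat] and [slice_dhat] differentiate this once and twice. *)
Let slice_const j z : dot d (E j) = 0 -> O1 z -> tangent_slice 2 z ->
  dot (f z) (E j) = dot x0 (E j).
Proof.
move=> dj O1z tz; have [dz mz] := chart_img_dom O1z.
have [_ /(_ _ dz)] := slice; rewrite mz => -[_ /(_ tz) /Nline[t]].
by rewrite /f /= => ->; rewrite dotDl dotZl dj mulr0 addr0.
Qed.

Let slice_hat u z j : val j != 0%N -> dot d (E j) = 0 -> O1 z ->
  tangent_slice 2 z -> tangent_slice 2 u -> hat gh_coframe u z j = 0.
Proof.
move=> j0 dj O1z tz tu; rewrite hat_coframeD//.
apply: (derive_slice chart_img_open1 O1z tz tu (C := dot x0 (E j))) => w O1w tw.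
exact: slice_const.
Qed.

Let slice_dhat u v y j : val j != 0%N -> dot d (E j) = 0 -> O1 y ->
  tangent_slice 2 y -> tangent_slice 2 u -> tangent_slice 2 v ->
  dhat gh_coframe u v y j = 0.
Proof.
move=> j0 dj O1y ty tu tv.
apply: (derive_slice chart_img_open1 O1y ty tu (C := 0)) => w O1w tw.
exact: slice_hat.
Qed.

Lemma gh_slice_stability y (e : 'I_2 -> 'rV[R]_4) v : O y ->
  tangent_slice 2 y -> tangent_frame (gh_metric X c) y e ->
  (forall a, ip (gh_metric X c y) v (e a) = 0) ->
  - calR_form (gh_metric X c) y e v -
    ip (gh_metric X c y) (calA (gh_metric X c) y e v) v =
  (gh_potential p m (f y) * hess_potential p (E 1) (E 1) (f y)
   - 2 * grad_potential p (E 1) (f y) ^+ 2) / (2 * gh_potential p m (f y) ^+ 3)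
  * ip (gh_metric X c y) v v.
Proof.
move=> Oy ty [et eo] vn; have O1y := OO1 Oy.
apply: (@local_frame_stability _ O (gh_metric X c) gh_coframe
  (fun z => gh_potential p m (f z)) (fun j z => grad_potential p (E j) (f z))
  (fun i j z => hess_potential p (E i) (E j) (f z))) => //.
- exact: chart_base_open.
- by move=> i j; apply: (smooth_subset OO1); exact: metric_smooth.
- by move=> z /OO1 Oz; exact: Defs.metric_sym.
- by move=> z u /OO1 Oz; exact: metric_pos.
- exact: smooth_coframe.
- by move=> z /fO; exact: gh_potential_gt0.
- exact: coframe_potential.
- by move=> z u j; exact: coframe_grad.
- exact: coframe_metric.
- exact: coframe_structure.
- by move=> z i j _; exact: hess_sym.
- by move=> z /fO; exact: (hess_trace HE).
- by move=> a; split; apply: slice_hat.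
- by move=> a b; split; apply: slice_dhat.
Qed.

End ChartGeometry.

(** * Continuity of the stability form *)

Section CurvatureContinuity.
Context {R : realType} {n : nat}.
Variables (O : set 'rV[R]_n) (G : 'rV[R]_n -> 'M[R]_n).
Hypothesis oO : open O.
Hypothesis sG : forall i j, smooth_fun O (fun y => G y i j).
Hypothesis uG : forall y, O y -> G y \in unitmx.
Variables (T : Type) (F : set_system T) (FF : Filter F).
Variables (Y : T -> 'rV[R]_n) (y : 'rV[R]_n).
Hypotheses (Oy : O y) (cY : Y t @[t --> F] --> y).

(** Convergence by coordinates reduces every limit below to sums and products of real functions. *)
Definition cvg_coord (U : T -> 'rV[R]_n) (u : 'rV[R]_n) : Prop :=
  forall i, U t 0 i @[t --> F] --> u 0 i.

Lemma cvg_smooth (g : 'rV[R]_n -> R) : smooth_fun O g ->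
  g (Y t) @[t --> F] --> g y.
Proof.
move=> sg; have cg : {for y, continuous g} by exact: smooth_continuous sg Oy.
exact: (cvg_comp _ _ cY cg).
Qed.

Lemma near_O : \forall t \near F, O (Y t).
Proof. by apply: cY; exact: open_nbhs_nbhs. Qed.

Lemma cvg_coordB U U' u u' : cvg_coord U u -> cvg_coord U' u' ->
  cvg_coord (fun t => U t - U' t) (u - u').
Proof.
move=> cU cU' i; rewrite !mxE; under eq_fun do rewrite !mxE.
by apply: cvgB; [exact: cU|exact: cU'].
Qed.

Lemma cvg_coordZ (a : T -> R) (l : R) U u : a t @[t --> F] --> l ->
  cvg_coord U u -> cvg_coord (fun t => a t *: U t) (l *: u).
Proof.
move=> ca cU i; rewrite !mxE; under eq_fun do rewrite !mxE.
by apply: cvgM => //; exact: cU.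
Qed.

Lemma cvg_coord_sum (I : Type) (r : seq I) (U : I -> T -> 'rV[R]_n) u :
  (forall i, cvg_coord (U i) (u i)) ->
  cvg_coord (fun t => \sum_(i <- r) U i t) (\sum_(i <- r) u i).
Proof.
move=> cU j; rewrite summxE; under eq_fun do rewrite summxE.
by apply: cvg_sumr => i _; exact: cU.
Qed.

Lemma cvg_coord_cst u : cvg_coord (fun=> u) u.
Proof. by move=> i; exact: cvg_cst. Qed.

Lemma cvg_ip U V u v : cvg_coord U u -> cvg_coord V v ->
  ip (G (Y t)) (U t) (V t) @[t --> F] --> ip (G y) u v.
Proof.
move=> cU cV; rewrite ipE; under eq_fun do rewrite ipE.
apply: cvg_sumr => i _; apply: cvg_sumr => j _; apply: cvgM.
  by apply: cvgM; [exact: cU|exact: cV].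
exact: cvg_smooth (sG i j).
Qed.

Lemma cvg_chr U W u w : cvg_coord U u -> cvg_coord W w ->
  cvg_coord (fun t => chr G (U t) (W t) (Y t)) (chr G u w y).
Proof.
move=> cU cW l; rewrite mxE; under eq_fun do rewrite mxE.
apply: cvg_sumr => i _; apply: cvg_sumr => j _; apply: cvgM.
  by apply: cvgM; [exact: cU|exact: cW].
exact: cvg_smooth (smooth_christoffel oO sG uG i j l).
Qed.

(** The derivative of [chr] written as a trilinear expression with continuous coefficients, a form
    in which the direction [u] may vary along the filter too. *)
Definition dchr (u v w z : 'rV[R]_n) : 'rV[R]_n :=
  \row_l \sum_(i < n) u 0 i * \sum_(j < n) \sum_(k < n)
    v 0 j * w 0 k * 'D_(delta_mx 0 i) (fun z => christoffel G z j k l) z.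

Lemma dchrE u v w z : O z -> 'D_u (chr G v w) z = dchr u v w z.
Proof.
move=> Oz.
have dc := @derivable_chr _ _ O G oO sG uG u v w z Oz.
rewrite (derive_mx dc).
apply/rowP => l; rewrite !mxE.
rewrite (smooth_deriveE oO (smooth_chr oO sG uG v w l))//.
apply: eq_bigr => i _; congr (_ * _).
have -> : (fun t => chr G v w t 0 l) = (fun t => \sum_(j < n) \sum_(k < n)
    v 0 j * w 0 k * christoffel G t j k l) by apply/funext => t; rewrite mxE.
apply: derive_val.
do 2![apply: is_derive_sumr => ? _]; apply: is_derive_scale.
exact: (smooth_is_derive oO (smooth_christoffel oO sG uG _ _ _)).
Qed.

Lemma cvg_dchr U V W u v w :
  cvg_coord U u -> cvg_coord V v -> cvg_coord W w ->
  cvg_coord (fun t => dchr (U t) (V t) (W t) (Y t)) (dchr u v w y).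
Proof.
move=> cU cV cW l; rewrite /dchr; under eq_fun do rewrite mxE; rewrite mxE.
apply: cvg_sumr => i _; apply: cvgM; first exact: cU.
apply: cvg_sumr => j _; apply: cvg_sumr => k _; apply: cvgM.
  by apply: cvgM; [exact: cV|exact: cW].
exact: cvg_smooth (smooth_partial i (smooth_christoffel oO sG uG j k l)).
Qed.

Lemma cvg_coordD U U' u u' : cvg_coord U u -> cvg_coord U' u' ->
  cvg_coord (fun t => U t + U' t) (u + u').
Proof.
move=> cU cU' i; rewrite !mxE; under eq_fun do rewrite !mxE.
by apply: cvgD; [exact: cU|exact: cU'].
Qed.

Lemma cvg_curvature U V W u v w :
  cvg_coord U u -> cvg_coord V v -> cvg_coord W w ->
  cvg_coord (fun t => curvature G (U t) (V t) (W t) (Y t)) (curvature G u v w y).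
Proof.
move=> cU cV cW.
have CE z a b d : O z -> curvature G a b d z = dchr a b d z + chr G a (chr G b d z) z -
    (dchr b a d z + chr G b (chr G a d z) z).
  by move=> Oz; rewrite curvatureE !dchrE.
have : cvg_coord (fun t => dchr (U t) (V t) (W t) (Y t) +
      chr G (U t) (chr G (V t) (W t) (Y t)) (Y t) -
    (dchr (V t) (U t) (W t) (Y t) + chr G (V t) (chr G (U t) (W t) (Y t)) (Y t)))
    (curvature G u v w y).
  rewrite CE//; apply: cvg_coordB; apply: cvg_coordD.
  - exact: cvg_dchr.
  - by apply: cvg_chr => //; exact: cvg_chr.
  - exact: cvg_dchr.
  - by apply: cvg_chr => //; exact: cvg_chr.
move=> C l; apply: cvg_trans (C l); apply: near_eq_cvg.
by apply: filterS near_O => t /CE ->.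
Qed.

Section Frame.
Variables (d : nat) (e' : T -> 'I_d -> 'rV[R]_n) (e : 'I_d -> 'rV[R]_n).
Variables (v' : T -> 'rV[R]_n) (v : 'rV[R]_n).
Hypotheses (ce : forall a, cvg_coord (e' ^~ a) (e a)) (cv : cvg_coord v' v).

Lemma cvg_calR_form :
  calR_form G (Y t) (e' t) (v' t) @[t --> F] --> calR_form G y e v.
Proof.
by apply: cvg_sumr => a _; apply: cvg_ip => //; exact: cvg_curvature.
Qed.

Lemma cvg_second_ff a b :
  cvg_coord (fun t => second_ff G (Y t) (e' t) (e' t a) (e' t b))
    (second_ff G y e (e a) (e b)).
Proof.
rewrite /second_ff /normal_part cov_cst; under eq_fun do rewrite cov_cst.
have cc := cvg_chr (@ce a) (@ce b).
apply: cvg_coordB => //; apply: cvg_coord_sum => k.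
by apply: cvg_coordZ => //; exact: cvg_ip.
Qed.

Lemma cvg_calA : cvg_coord (fun t => calA G (Y t) (e' t) (v' t)) (calA G y e v).
Proof.
apply: cvg_coord_sum => a; apply: cvg_coord_sum => b.
apply: cvg_coordZ; last exact: cvg_second_ff.
by apply: cvg_ip => //; exact: cvg_second_ff.
Qed.

Lemma cvg_stability_form :
  - calR_form G (Y t) (e' t) (v' t) - ip (G (Y t)) (calA G (Y t) (e' t) (v' t)) (v' t)
    @[t --> F] --> - calR_form G y e v - ip (G y) (calA G y e v) v.
Proof.
apply: cvgB; first by apply: cvgN; exact: cvg_calR_form.
by apply: cvg_ip => //; exact: cvg_calA.
Qed.

End Frame.
End CurvatureContinuity.

Section GramSchmidt.
Context {R : realType} {n : nat}.
Implicit Types (g : 'M[R]_n) (e : 'I_2 -> 'rV[R]_n) (v : 'rV[R]_n).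

Definition gs_vec g e : 'rV[R]_n :=
  e 1 - (ip g (e 1) (e 0) / ip g (e 0) (e 0)) *: e 0.

Definition gram_schmidt g e (a : 'I_2) : 'rV[R]_n :=
  let w := if a == 0 then e 0 else gs_vec g e in (Num.sqrt (ip g w w))^-1 *: w.

Lemma ord2_ind (P : 'I_2 -> Prop) : P 0 -> P 1 -> forall a, P a.
Proof.
move=> P0 P1; case=> -[|[|//]] a2.
- by rewrite (_ : Ordinal a2 = 0)//; exact: val_inj.
- by rewrite (_ : Ordinal a2 = 1)//; exact: val_inj.
Qed.

Lemma gram_schmidt_orth g e : g^T = g ->
  (forall u, u != 0 -> 0 < ip g u u) -> e 0 != 0 -> gs_vec g e != 0 ->
  forall a b, ip g (gram_schmidt g e a) (gram_schmidt g e b) = (a == b)%:R.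
Proof.
move=> gT gpos e0 w0.
have L0 := gpos _ e0; have M0 := gpos _ w0.
have unit w : 0 < ip g w w ->
    ip g ((Num.sqrt (ip g w w))^-1 *: w) ((Num.sqrt (ip g w w))^-1 *: w) = 1.
  move=> w1; rewrite ipZl ipZr mulrA -invfM -expr2 sqr_sqrtr ?ltW//.
  by rewrite mulVf// gt_eqF.
have ew : ip g (e 0) (gs_vec g e) = 0.
  rewrite ipC// /gs_vec ipBl ipZl divfK ?subrr// gt_eqF//.
elim/ord2_ind; elim/ord2_ind; rewrite /gram_schmidt /=.
- exact: unit.
- by rewrite ipZl ipZr ew !mulr0.
- by rewrite ipZl ipZr ipC// ew !mulr0.
- exact: unit.
Qed.

Lemma tangent_slice_gs d g e a : (forall a, tangent_slice d (e a)) ->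
  tangent_slice d (gram_schmidt g e a).
Proof.
move=> te j dj; have te0 := te 0 j dj; have te1 := te 1 j dj.
by elim/ord2_ind : a; rewrite /gram_schmidt /gs_vec /= !mxE ?te0 ?te1
  ?(mulr0, oppr0, addr0).
Qed.

End GramSchmidt.

Section Limit.
Context {R : realType} {n : nat}.
Variables (O : set 'rV[R]_n) (G : 'rV[R]_n -> 'M[R]_n).
Hypothesis oO : open O.
Hypothesis sG : forall i j, smooth_fun O (fun y => G y i j).
Hypothesis symG : forall y, O y -> (G y)^T = G y.
Hypothesis posG : forall y u, O y -> u != 0 -> 0 < ip (G y) u u.

(* A lower bound on [-calR - calA] passes to limits of points: an orthonormal
   frame and a normal vector at the limit are approximated by Gram-Schmidt. *)
Lemma stability_form_limit (T : topologicalType) (F : set_system T) (FF : ProperFilter F)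
    (Y : T -> 'rV[R]_n) (y : 'rV[R]_n) (kappa : R) (e : 'I_2 -> 'rV[R]_n) v :
  O y -> Y t @[t --> F] --> y ->
  (\forall t \near F, forall (e' : 'I_2 -> 'rV[R]_n) v',
    tangent_frame G (Y t) e' -> (forall a, ip (G (Y t)) v' (e' a) = 0) ->
    kappa * ip (G (Y t)) v' v' <=
    - calR_form G (Y t) e' v' - ip (G (Y t)) (calA G (Y t) e' v') v') ->
  tangent_frame G y e -> (forall a, ip (G y) v (e a) = 0) ->
  kappa * ip (G y) v v <= - calR_form G y e v - ip (G y) (calA G y e v) v.
Proof.
move=> Oy cY bound [te oe] ve.
have uG z : O z -> G z \in unitmx by move=> Oz; apply: ip_unitmx => u; exact: posG.
have nonzero u : ip (G y) u u = 1 -> u != 0.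
  move=> u1; apply/eqP => u0; move: u1; rewrite u0 /ip !mul0mx mxE => /eqP.
  by rewrite eq_sym oner_eq0.
have o00 : ip (G y) (e 0) (e 0) = 1 by rewrite oe.
have o11 : ip (G y) (e 1) (e 1) = 1 by rewrite oe.
have o10 : ip (G y) (e 1) (e 0) = 0 by rewrite oe.
have e00 := nonzero _ o00.
pose e' t := gram_schmidt (G (Y t)) e.
(* Removing the tangential part restores normality at [Y t]; the correction tends to zero because
   [v] is normal at [y]. *)
pose v' t := v - \sum_(a < 2) ip (G (Y t)) v (e' t a) *: e' t a.
have cst u := @cvg_coord_cst R n T F FF u.
have cip U V u w : cvg_coord F U u -> cvg_coord F V w ->
    ip (G (Y t)) (U t) (V t) @[t --> F] --> ip (G y) u w.
  exact: (cvg_ip sG FF Oy cY).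
have normalize U u : cvg_coord F U u -> ip (G y) u u = 1 ->
    cvg_coord F (fun t => (Num.sqrt (ip (G (Y t)) (U t) (U t)))^-1 *: U t) u.
  move=> cU u1; rewrite -[X in cvg_coord _ _ X]scale1r; apply: cvg_coordZ => //.
  have c1 := cip _ _ _ _ cU cU; rewrite u1 in c1.
  rewrite -invr1 -[X in X^-1]sqrtr1; apply: cvgV; first by rewrite sqrtr1 oner_eq0.
  by apply: (cvg_comp _ _ c1); exact: sqrt_continuous.
have cw : cvg_coord F (fun t => gs_vec (G (Y t)) e) (e 1).
  rewrite -[X in cvg_coord _ _ X]subr0 -(scale0r (e 0)).
  apply: cvg_coordB => //; apply: cvg_coordZ => //.
  have -> : 0 = ip (G y) (e 1) (e 0) / ip (G y) (e 0) (e 0) by rewrite o10 mul0r.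
  apply: cvgM; first exact: cip.
  by apply: cvgV; [rewrite o00 oner_eq0|exact: cip].
have ce a : cvg_coord F (e' ^~ a) (e a).
  by elim/ord2_ind : a; apply: normalize.
have cv : cvg_coord F v' v.
  rewrite -[X in cvg_coord _ _ X]subr0; apply: cvg_coordB => //.
  have s0 : \sum_(a < 2) ip (G y) v (e a) *: e a = 0 :> 'rV[R]_n.
    by rewrite big1// => a _; rewrite ve scale0r.
  rewrite -[X in cvg_coord _ _ X]s0; apply: cvg_coord_sum => a.
  by apply: cvg_coordZ; [apply: cip; [exact: cst|exact: ce]|exact: ce].
(* The vector tends to [e 1], which has a nonzero coordinate. *)
have cw0 : \forall t \near F, gs_vec (G (Y t)) e != 0.
  have [i ei] : exists i, e 1 0 i != 0.
    apply/existsP; apply: contraT; rewrite negb_exists => /forallP H.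
    have := nonzero _ o11; rewrite (_ : e 1 = 0) ?eqxx//.
    by apply/rowP => i; rewrite mxE; apply/eqP; have := H i; rewrite negbK.
  have := cw i => /cvgr_neq0 /(_ ei); apply: filterS => t.
  by apply: contraNneq => ->; rewrite mxE.
have cQ := cvg_stability_form oO sG uG FF Oy cY ce cv.
have cI : kappa * ip (G (Y t)) (v' t) (v' t) @[t --> F] --> kappa * ip (G y) v v.
  by apply: cvgMl_tmp; exact: cip.
apply: (@ler_cvg_to _ F FF _ _ _ _ _ cI cQ).
have nO := near_O oO Oy cY.
move: nO cw0 bound; apply: filterS3 => t Ot wt bt.
have oe' := gram_schmidt_orth (symG Ot) (fun u => posG Ot) e00 wt.
apply: bt.
  by split=> [a|//]; exact: tangent_slice_gs.
move=> a; rewrite /v' ipBl ip_suml (bigD1 a)//= big1 ?addr0 => [|b ba].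
  by rewrite ipZl oe' eqxx mulr1 subrr.
by rewrite ipZl oe' (negbTE ba) mulr0.
Qed.

End Limit.

Lemma near_dnbhs_neq (R : realType) (a : R) : \forall h \near 0^', h != a.
Proof.
have [->|a0] := eqVneq a 0; first exact: nbhs_dnbhs_neq.
have ha : \forall h \near (0 : R)^', `|h| < `|a|.
  by apply: dnbhs0_lt; rewrite normr_gt0.
by move: ha; apply: filterS => h; apply: contraTneq => ->; rewrite ltxx.
Qed.

Theorem proposition1p2 (R : realType) (k : nat) (hk : (2 <= k)%N)
  (p : 'I_k -> 'rV[R]_3) (p_inj : injective p)
  (m : R) (X : gibbons_hawking p m)
  (hX : multi_Eguchi_Hanson X \/ multi_Taub_NUT X)
  (N : set X) (N_compact : compact N) (N_surface : submanifold 2 N)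
  (N_invariant : circle_invariant N) (N_minimal : minimal (gh_metric X) 2 N)
  (p1 := p (Ordinal (ltnW hk))) (p2 := p (Ordinal hk))
  (N_segment : @gh_proj R k p m X @` N = straight_segment p1 p2)
  (q := 2^-1 *: (p1 + p2)) (a := euclid (p1 - p2) / 2)
  (Rk : R) (hRk : largest_root (threshold_poly R k) Rk)
  (s : R) (hs : Num.max (Num.sqrt ((k%:R - 2) / 2)) Rk <= s)
  (hfar : forall i : 'I_k, (1 < i)%N -> (s + 1) * a < euclid (q - p i)) :
  strongly_stable (gh_metric X) 2 N.
Proof.
have Rs : Rk <= s by apply: le_trans hs; rewrite le_max lexx orbT.
have [s4 ks] := threshold_bound hk hRk Rs.
have s0 : 0 < s by apply: lt_le_trans s4.
have m0 : 0 <= m by case: hX => [->|/ltW].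
have k0 : (0 < k)%N by exact: ltnW hk.
have p21 : p2 - p1 != 0.
  by rewrite subr_eq0; apply/eqP => /p_inj/eqP; rewrite -val_eqE.
have [E HE E1] := oriented_frame_exists p21.
have Ed j : dot (E 1) (E j) = 0 -> dot (p2 - p1) (E j) = 0.
  rewrite E1 dotZl => /eqP; rewrite mulf_eq0 invr_eq0 euclid_eq0 (negbTE p21).
  by move/eqP.
have N_line x : N x -> exists t, gh_proj x = p1 + t *: (p2 - p1).
  move=> Nx; have [t _ <-] : straight_segment p1 p2 (gh_proj x).
    by rewrite -N_segment; exists x.
  by exists t; apply/rowP => j; rewrite !mxE; ring.
have kappa0 := curvature_lower_bound_gt0 hk p_inj m0 s0 ks.
have interior c z t (e : 'I_2 -> 'rV[R]_4) v : slice_chart 2 N c -> chart_img c setT z ->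
    tangent_slice 2 z -> 0 < t < 1 ->
    gh_proj (chart_inv c z) = (1 - t) *: p1 + t *: p2 ->
    tangent_frame (gh_metric X c) z e ->
    (forall a, ip (gh_metric X c z) v (e a) = 0) ->
    curvature_lower_bound hk p m s * ip (gh_metric X c z) v v <=
    - calR_form (gh_metric X c) z e v -
      ip (gh_metric X c z) (calA (gh_metric X c) z e v) v.
  move=> slice z1 tz t01 zt te vn; have [ac _] := slice.
  have [phi0 bound] := segment_curvature_bound p_inj m0 s0 ks hfar HE E1 t01.
  have Uz := segment_gh_base p_inj s0 hfar HE E1 t01.
  have zU : chart_img c (@gh_proj R k p m X @^-1` gh_base p) z.
    by apply/chart_imgE; split => //=; rewrite zt.
  rewrite (gh_slice_stability ac m0 k0 HE slice N_line (Ed _ (frame12 HE))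
    (Ed _ (frame13 HE)) zU tz te vn) /= zt.
  apply: ler_wpM2r bound; have [->|v0] := eqVneq v 0.
    by rewrite /ip !mul0mx mxE.
  by apply/ltW/metric_pos.
move=> c x e v slice cx Nx y te vn v0.
have [ac sc] := slice; have oO := @chart_img_open1 _ _ _ _ X c.
have y1 : chart_img c setT y by exists x.
have ty : tangent_slice 2 y by apply/sc.
(* The first axis is tangent to the slice, so this line runs in [N]. For small nonzero [h] it misses
   both fixed points, whether or not [y] is one of them, so no case distinction is needed. *)
pose Y (h : R) : 'rV[R]_4 := h *: delta_mx 0 0 + y.
have cY : Y h @[h --> 0^'] --> y.
  by apply: cvg_within_filter; exact: cvg_ray.
(* Every row [w] is avoided, so [chart_map c] may be applied below to a fixed point outside the
   chart, where its value is meaningless. *)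
have avoid w : \forall h \near 0^', Y h != w.
  have := near_dnbhs_neq (w 0 0 - y 0 0); apply: filterS => h.
  by apply: contraNneq => <-; rewrite !mxE mulr1 addrK.
have [x1 [px1 ux1]] := gh_singular_fiber X (Ordinal (ltnW hk)).
have [x2 [px2 ux2]] := gh_singular_fiber X (Ordinal hk).
have bound : \forall h \near 0^', forall (e' : 'I_2 -> 'rV[R]_4) v',
    tangent_frame (gh_metric X c) (Y h) e' ->
    (forall a, ip (gh_metric X c (Y h)) v' (e' a) = 0) ->
    curvature_lower_bound hk p m s * ip (gh_metric X c (Y h)) v' v' <=
    - calR_form (gh_metric X c) (Y h) e' v' -
      ip (gh_metric X c (Y h)) (calA (gh_metric X c) (Y h) e' v') v'.
  have nO : \forall h \near 0^', chart_img c setT (Y h).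
    exact: (near_O oO y1 cY).
  move: nO (avoid (chart_map c x1)) (avoid (chart_map c x2)).
  apply: filterS3 => h Y1 /eqP Yx1 /eqP Yx2 e' v' te' vn'.
  have [dY mY] := chart_img_dom Y1.
  have tY : tangent_slice 2 (Y h).
    move=> j j2; rewrite !mxE (ty j j2) addr0.
    by rewrite (_ : (j == 0) = false) ?andbF ?mulr0//; apply: contraTF j2 => /eqP ->.
  have NY : N (chart_inv c (Y h)) by apply/sc => //; rewrite mY.
  have [t t01 tE] : straight_segment p1 p2 (gh_proj (chart_inv c (Y h))).
    by rewrite -N_segment; exists (chart_inv c (Y h)).
  apply: (interior c (Y h) t) => //; move: t01; rewrite /= in_itv /= => /andP[t0 t1].
  (* An end value of [t] would put the point over an end of the segment, hence at the unique point
     of that fibre, which the line avoids. *)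
  rewrite !lt_def t0 t1 !andbT; apply/andP; split.
    apply/eqP => tz; apply: Yx1; rewrite (ux1 (chart_inv c (Y h))) ?mY//.
    by rewrite -tE tz subr0 scale1r scale0r addr0.
  apply/eqP => tz; apply: Yx2; rewrite (ux2 (chart_inv c (Y h))) ?mY//.
  by rewrite -tE -tz subrr scale1r scale0r add0r.
have vn' b : ip (gh_metric X c y) v (e b) = 0 by apply: vn; have [et _] := te.
have sG i j : smooth_fun (chart_img c setT) (fun z => gh_metric X c z i j).
  exact: metric_smooth.
have symG z : chart_img c setT z -> (gh_metric X c z)^T = gh_metric X c z.
  exact: Defs.metric_sym.
have posG z u : chart_img c setT z -> u != 0 -> 0 < ip (gh_metric X c z) u u.
  exact: metric_pos.
(* The limit preserves only the weak inequality; strictness comes from the positive constant. *)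
apply: lt_le_trans (stability_form_limit oO sG symG posG _ y1 cY bound te vn').
by rewrite mulr_gt0// posG.
Qed.
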